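(* For the generic $h \in \mathcal{H}(\{0,1\}^{\mathbb{N}})$, the induced map $\widetilde{h} : \mathcal{M}(\{0,1\}^{\mathbb{N}}) \to \mathcal{M}(\{0,1\}^{\mathbb{N}})$ has all of the following properties: (a) $\widetilde{h}$ has uncountably many periodic points of each period $p \geq 1$. (b) Any neighborhood of any periodic point of $\widetilde{h}$ of period $p$ contains uncountably many periodic points of $\widetilde{h}$ of period $kp$, for each $k \in \mathbb{N}$. (c) $R(\widetilde{h}) = \Omega(\widetilde{h})$ and $CR(\widetilde{h}) = \mathcal{M}(\{0,1\}^{\mathbb{N}})$. (d) $\Omega(\widetilde{h})$ has empty interior in $\mathcal{M}(\{0,1\}^{\mathbb{N}})$. (e) $P(\widetilde{h})$ is dense in $\Omega(\widetilde{h})$.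
   Context: The Cantor space $\{0,1\}^{\mathbb{N}}$ ($\mathbb{N}=\{1,2,\dots\}$) carries the metric $d(\sigma,\sigma)=0$ and $d(\sigma,\tau)=1/n$, where $n$ is the least positive integer with $\sigma(n)\ne\tau(n)$. $\mathcal{H}(\{0,1\}^{\mathbb{N}})$ is the space of all homeomorphisms of $\{0,1\}^{\mathbb{N}}$ onto itself with the metric $\tilde d(f,g)=\max_x d(f(x),g(x))$; it is a Baire space. ''The generic element of a Baire space $Z$ has property $P$'' means that the set of elements of $Z$ failing $P$ is of the first category (meager) in $Z$. For a compact metric space $(M,d)$, $\mathcal{M}(M)$ is the space of Borel probability measures on $M$ with the Prohorov metric $d_P(\mu,\nu)=\inf\{\delta>0:\mu(X)\le\nu(X^\delta)+\delta \text{ and } \nu(X)\le\mu(X^\delta)+\delta \text{ for all Borel } X\subset M\}$, where $X^\delta=\{x\in M: d(x,X)<\delta\}$; it is a compact metric space. For a continuous map $f:M\to M$, the induced map $\widetilde f:\mathcal{M}(M)\to\mathcal{M}(M)$ is $(\widetilde f(\mu))(X)=\mu(f^{-1}(X))$ for Borel $X$. For a continuous self-map $g$ of a compact metric space with metric $\rho$: $P(g)$, $R(g)$, $\Omega(g)$, $CR(g)$ denote the sets of periodic, recurrent, nonwandering and chain recurrent points of $g$. A point $x$ is periodic of period $p\ge1$ if $g^p(x)=x$ and $g^j(x)\ne x$ for $1\le j<p$; $x$ is recurrent if for every neighborhood $U$ of $x$ there is $n\ge1$ with $g^n(x)\in U$; $x$ is nonwandering if for every neighborhood $U$ of $x$ there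 is $n\ge1$ with $g^n(U)\cap U\ne\emptyset$; $x$ is chain recurrent if for every $\delta>0$ there are $k\ge1$ and points $x_0=x,x_1,\dots,x_k=x$ with $\rho(g(x_n),x_{n+1})<\delta$ for $0\le n<k$. *)

(* Defs.v *)
From HB Require Import structures.
From mathcomp Require Import all_boot all_order all_algebra.
From mathcomp Require Import all_classical all_reals all_analysis.
From mathcomp Require Import lra.
Import Order.TTheory GRing.Theory Num.Theory.
Import numFieldNormedType.Exports.

Set Implicit Arguments.
Unset Strict Implicit.
Unset Printing Implicit Defensive.

Local Open Scope classical_set_scope.
Local Open Scope ring_scope.

#[short(type="pmetricType")]
HB.structure Definition PointedMetric (R : numDomainType) :=
  {T of Pointed T & Metric R T}.

Section category.
Variable T : topologicalType.

Definition nowhere_dense (A : set T) := (closure A)° = set0.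

Definition meager (A : set T) :=
  exists2 F : nat -> set T, forall n, nowhere_dense (F n) & A = \bigcup_n F n.

Definition generic (P : T -> Prop) := meager [set x | ~ P x].

Definition dense_in (A B : set T) := A `<=` B /\ B `<=` closure A.

Definition is_homeo (f : T -> T) :=
  exists g : T -> T, [/\ cancel f g, cancel g f, continuous f & continuous g].

End category.

Section dynamics.
Variables (R : realType) (M : metricType R) (g : M -> M).

Definition periodic_pts (p : nat) : set M := [set x |
  [/\ (0 < p)%N, iter p g x = x &
      forall j, (0 < j < p)%N -> iter j g x <> x]].

Definition all_periodic_pts : set M := \bigcup_p periodic_pts p.

Definition recurrent_pts : set M := [set x |
  forall U, nbhs x U -> exists2 n, (0 < n)%N & U (iter n g x)].

Definition nonwandering_pts : set M := [set x |
  forall U, nbhs x U -> exists2 n, (0 < n)%N & (iter n g @` U) `&` U !=set0].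

Definition chain_recurrent_pts : set M := [set x |
  forall delta : R, 0 < delta -> exists2 k, (0 < k)%N &
    exists u : nat -> M, [/\ u 0%N = x, u k = x &
      forall n, (n < k)%N -> mdist (g (u n)) (u n.+1) < delta]].

End dynamics.

(** Coordinates of [cantor_space] are indexed from 0, hence the shift by one:
    [s i] is the coordinate of index i + 1. *)
Section cantor_metric.
Variable R : realType.
Implicit Types s t u : cantor_space.

Lemma cantor_neqP s t : s <> t -> exists i, s i != t i.
Proof.
move=> st; apply: contrapT => /forallNP h; apply: st; apply/funext => i.
by have /negP := h i; rewrite negbK => /eqP.
Qed.

Definition cantor_dist s t : R :=
  match pselect (s = t) with
  | left _ => 0
  | right st => (ex_minn (cantor_neqP st)).+1%:R^-1
  end.

Lemma cantor_distxx s : cantor_dist s s = 0.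
Proof. by rewrite /cantor_dist; case: pselect. Qed.

Lemma cantor_distP s t : s <> t ->
  exists n, [/\ cantor_dist s t = n.+1%:R^-1, s n <> t n &
    forall i, (i < n)%N -> s i = t i].
Proof.
rewrite /cantor_dist; case: pselect => // st _.
case: ex_minnP => m /eqP mP mmin; exists m; split => // i im.
by apply/eqP/negPn/negP => /mmin; rewrite leqNgt im.
Qed.

Lemma cantor_dist_ltP s t n :
  cantor_dist s t < n.+1%:R^-1 <-> forall i, (i <= n)%N -> s i = t i.
Proof.
have [->|/eqP/cantor_distP[m [-> mP mmin]]] := eqVneq s t.
  by rewrite cantor_distxx; split => // _; rewrite invr_gt0.
rewrite ltf_pV2 ?posrE ?ltr0n// ltr_nat ltnS; split => [nm i ilen|h].
  by apply: mmin; exact: leq_ltn_trans nm.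
by rewrite ltnNge; apply/negP => /h.
Qed.

Lemma cantor_dist_ge0 s t : 0 <= cantor_dist s t.
Proof. by rewrite /cantor_dist; case: pselect => // ?; rewrite invr_ge0. Qed.

Lemma cantor_dist_le1 s t : cantor_dist s t <= 1.
Proof.
rewrite /cantor_dist; case: pselect => // st.
by rewrite invf_le1 ?ltr0n// ler1n.
Qed.

Lemma cantor_dist_positivity s t : cantor_dist s t = 0 -> s = t.
Proof.
have [//|/eqP/cantor_distP[m [-> _ _]]] := eqVneq s t.
by move=> /eqP; rewrite invr_eq0 pnatr_eq0.
Qed.

Lemma cantor_dist_triangle t s u :
  cantor_dist s u <= cantor_dist s t + cantor_dist t u.
Proof.
have [->|/eqP/cantor_distP[m [-> mP _]]] := eqVneq s u.
  by rewrite cantor_distxx addr_ge0 ?cantor_dist_ge0.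
rewrite leNgt; apply/negP => h; apply: mP.
transitivity (t m).
  have /cantor_dist_ltP -> // : cantor_dist s t < m.+1%:R^-1.
  by apply: le_lt_trans h; rewrite lerDl cantor_dist_ge0.
have /cantor_dist_ltP -> // : cantor_dist t u < m.+1%:R^-1.
by apply: le_lt_trans h; rewrite lerDr cantor_dist_ge0.
Qed.

Lemma cantor_dist_sym s t : cantor_dist s t = cantor_dist t s.
Proof.
have [->//|/eqP st] := eqVneq s t.
have [m [-> mP mmin]] := cantor_distP st.
have [n [-> nP nmin]] := cantor_distP (nesym st).
have [mn|nm|->//] := ltngtP m n.
- by have := nmin _ mn; move=> /esym.
- by have := mmin _ nm; move=> /esym.
Qed.

Let ball s (e : R) := [set t | cantor_dist s t < e].

Let ball_center s (e : R) : 0 < e -> ball s e s.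
Proof. by rewrite /ball/= cantor_distxx. Qed.

Let ball_sym s t (e : R) : ball s e t -> ball t e s.
Proof. by rewrite /ball/= cantor_dist_sym. Qed.

Let ball_triangle s t u (e1 e2 : R) :
  ball s e1 t -> ball t e2 u -> ball s (e1 + e2) u.
Proof.
by move=> st tu; apply: le_lt_trans (cantor_dist_triangle t _ _) _; exact: ltrD.
Qed.

Let coord_ent i :
  entourage [set p : cantor_space * cantor_space | p.1 i = p.2 i].
Proof.
pose TS (i : nat) := @initial_topology (forall _ : nat, bool) bool (@proj _ (fun=> bool) i).
have ent : `[< @entourage (TS i) [set p : cantor_space * cantor_space | p.1 i = p.2 i] >].
  apply/asboolP; exists (diagonal : set (bool * bool)).
    by rewrite uniform_discrete => _ [b _ <-]; exact/diagonalP.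
  by move=> [s t] /= /diagonalP.
exists [set p : cantor_space * cantor_space | p.1 i = p.2 i] => //.
pose ie := exist (fun p : {classic nat} * set (cantor_space * cantor_space) =>
  is_true `[< @entourage (TS p.1) p.2 >]) (i, _) ent.
by refine (@finI_from1 _ _ _ _ ie _).
Qed.

Let cantor_entourageE : entourage = entourage_ ball.
Proof.
have FE : Filter (entourage_ ball).
  apply: filter_from_filter; first by exists 1 => /=.
  move=> a b /= a0 b0; exists (Num.min a b); first by rewrite lt_min a0.
  by move=> p; rewrite /ball/= lt_min => /andP[].
apply/seteqP; split => E.
- move=> [_ [F _ <-]] FsE; apply: (@filterS _ _ FE _ _ FsE).
  apply: filter_bigI => -[[i A] /= iA] _; move: (iA) => /asboolP[B entB BA].
  exists i.+1%:R^-1; first by rewrite /= invr_gt0.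
  move=> [s t] /cantor_dist_ltP /= st; apply: BA.
  by rewrite /preimage /unstable.map_pair /= /proj st//; exact: entourage_refl.
- move=> [e /= e0 eE].
  have [n ne] : exists n : nat, n.+1%:R^-1 < e.
    have [n _ /(_ n (leqnn n)) ?] := near_infty_natSinv_lt (PosNum e0).
    by exists n.
  have : entourage (\bigcap_(i in [set i | (i <= n)%N])
    [set p : cantor_space * cantor_space | p.1 i = p.2 i]).
    elim: n {ne} => [|n IHn].
      by apply: filterS (coord_ent 0) => p /= p0 i; rewrite /= leqn0 => /eqP ->.
    apply: filterS (filterI IHn (coord_ent n.+1)) => p /= [pn pn1] i /=.
    by rewrite leq_eqVlt => /predU1P[->//|]; exact: pn.
  apply: filterS => -[s t] /= st; apply: eE => /=.
  by apply: lt_trans ne; apply/cantor_dist_ltP => i; exact: st.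
Qed.

HB.instance Definition _ := Uniform_isPseudoMetric.Build R cantor_space
  ball_center ball_sym ball_triangle cantor_entourageE.

Let ballEmdist s d : pseudometric_structure.ball s d = [set t | cantor_dist s t < d].
Proof. by []. Qed.

HB.instance Definition _ := PseudoMetric_isMetric.Build R cantor_space
  cantor_dist_ge0 cantor_dist_positivity ballEmdist.

End cantor_metric.

(** Elements of [probability _ R] are functions on all subsets; requiring the
    value 0 off the Borel sets makes equality of measures the equality of their
    values on Borel sets. *)
Section borel_probability.
Variables (R : realType) (T : pmetricType R).
Local Open Scope ereal_scope.

Definition borel_type := g_sigma_algebraType (@open T).

Definition borel_set (X : set T) := measurable (X : set borel_type).

Record borel_prob := BorelProb {
  borel_prob_val :> probability borel_type R ;
  borel_prob_off : forall X, ~ borel_set X -> borel_prob_val X = 0 }.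

HB.instance Definition _ := gen_eqMixin borel_prob.
HB.instance Definition _ := gen_choiceMixin borel_prob.

Lemma borel_open (X : set T) : open X -> borel_set X.
Proof. exact: sub_sigma_algebra. Qed.

Lemma borel_closed (X : set T) : closed X -> borel_set X.
Proof.
by move=> cX; rewrite -[X]setCK; apply: measurableC; apply: borel_open; exact: closed_openC.
Qed.

Lemma borel_prob_eq (mu nu : borel_prob) :
  (forall X, borel_set X -> mu X = nu X) -> mu = nu.
Proof.
move=> munu.
have e : (mu : set T -> \bar R) = nu.
  apply/funext => X; have [/munu//|bX] := pselect (borel_set X).
  by rewrite (borel_prob_off mu bX) (borel_prob_off nu bX).
case: mu nu e {munu} => -[mu mc] /= mo [[nu nc] no] /= e.
subst nu; have ? : mc = nc; last by subst nc; congr BorelProb; exact: Prop_irrelevance.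
case: mc {mo} => -[a1 a2] [a3] [a4] [a5] [a6] [a7] [a8].
case: nc {no} => -[b1 b2] [b3] [b4] [b5] [b6] [b7] [b8].
have ? := Prop_irrelevance a1 b1; have ? := Prop_irrelevance a2 b2.
have ? := Prop_irrelevance a3 b3; have ? := Prop_irrelevance a4 b4.
have ? := Prop_irrelevance a5 b5; have ? := Prop_irrelevance a6 b6.
have ? := Prop_irrelevance a7 b7; have ? := Prop_irrelevance a8 b8.
by subst.
Qed.

(** The distance from a point to the empty set is +oo. *)
Definition enlarge (X : set T) (delta : R) : set T :=
  [set x | ereal_inf [set (mdist x y)%:E | y in X] < delta%:E].

Lemma enlargeP X delta x :
  enlarge X delta x <-> exists2 y, X y & (mdist x y < delta)%R.
Proof.
split => [/ereal_inf_lt[_ [y Xy <-]]|[y Xy xy]]; first by exists y.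
by apply: le_lt_trans (_ : (mdist x y)%:E < _) => //; apply: ereal_inf_lbound; exists y.
Qed.

Definition prohorov_set (mu nu : borel_prob) : set R := [set delta |
  (0 < delta)%R /\ forall X, borel_set X ->
    mu X <= nu (enlarge X delta) + delta%:E /\
    nu X <= mu (enlarge X delta) + delta%:E].

Definition prohorov_dist (mu nu : borel_prob) : R := inf (prohorov_set mu nu).

Lemma enlarge_open X delta : open (enlarge X delta).
Proof.
rewrite openE => x /enlargeP[y Xy xy]; apply/nbhs_ballP.
exists (delta - mdist x y)%R; first by rewrite /= subr_gt0.
move=> z; rewrite ballEmdist/= => xz; apply/enlargeP; exists y => //.
apply: (le_lt_trans (metric_triangle z x y)).
by rewrite metric_sym -ltrBrDr.
Qed.

Lemma enlarge_enlarge X d1 d2 :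
  enlarge (enlarge X d1) d2 `<=` enlarge X (d1 + d2).
Proof.
move=> x /enlargeP[y /enlargeP[z Xz yz] xy]; apply/enlargeP; exists z => //.
by apply: (le_lt_trans (metric_triangle x y z)); rewrite addrC ltrD.
Qed.

Lemma bigcap_enlarge_closed X : closed X ->
  \bigcap_n enlarge X (n.+1%:R^-1)%R = X.
Proof.
move=> cX; apply/seteqP; split => [x Xx|x Xx n _].
  apply: cX => U /nbhs_ballP[e /= e0 eU].
  have [n _ /(_ n (leqnn n)) /= ne] := near_infty_natSinv_lt (PosNum e0).
  have /enlargeP[y Xy xy] := Xx n I.
  exists y; split => //; apply: eU; rewrite ballEmdist/=.
  exact: lt_trans ne.
by apply/enlargeP; exists x => //; rewrite mdistxx invr_gt0.
Qed.

Lemma borel_enlarge X delta : borel_set (enlarge X delta).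
Proof. by apply: borel_open; exact: enlarge_open. Qed.

Lemma prohorov_set_nonempty mu nu : prohorov_set mu nu !=set0.
Proof.
exists 1%R; split => // X bX; split.
  by rewrite (le_trans (probability_le1 mu bX))// leeDr// measure_ge0.
by rewrite (le_trans (probability_le1 nu bX))// leeDr// measure_ge0.
Qed.

Lemma prohorov_set_lb mu nu : lbound (prohorov_set mu nu) 0%R.
Proof. by move=> d [/ltW]. Qed.

Lemma prohorov_set_inf mu nu : has_inf (prohorov_set mu nu).
Proof.
by split; [exact: prohorov_set_nonempty|exists 0%R; exact: prohorov_set_lb].
Qed.

Lemma prohorov_set_up mu nu d e :
  (d <= e)%R -> prohorov_set mu nu d -> prohorov_set mu nu e.
Proof.
move=> de [d0 H]; split; first exact: lt_le_trans de.
have sub X : enlarge X d `<=` enlarge X e.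
  move=> x /enlargeP[y Xy xy]; apply/enlargeP; exists y => //.
  exact: lt_le_trans de.
move=> X bX; have [H1 H2] := H _ bX; split.
  rewrite (le_trans H1)// leeD ?lee_fin// le_measure ?inE//; exact: borel_enlarge.
rewrite (le_trans H2)// leeD ?lee_fin// le_measure ?inE//; exact: borel_enlarge.
Qed.

Lemma prohorov_set_gt mu nu d :
  (prohorov_dist mu nu < d)%R -> prohorov_set mu nu d.
Proof.
move=> /inf_lt[|e]; first exact: prohorov_set_nonempty.
by move=> He ed; apply: prohorov_set_up He; exact: ltW.
Qed.

Lemma prohorov_set_ge mu nu d :
  prohorov_set mu nu d -> (prohorov_dist mu nu <= d)%R.
Proof. by apply: ge_inf; exists 0%R; exact: prohorov_set_lb. Qed.

Lemma prohorov_dist_ge0 mu nu : (0 <= prohorov_dist mu nu)%R.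
Proof.
by apply: lb_le_inf; [exact: prohorov_set_nonempty|exact: prohorov_set_lb].
Qed.

Lemma prohorov_distxx mu : prohorov_dist mu mu = 0%R.
Proof.
apply/eqP; rewrite eq_le prohorov_dist_ge0 andbT; apply/ler_addgt0Pl => e e0.
rewrite addr0; apply: prohorov_set_ge; split => // X bX.
have XX : mu X <= mu (enlarge X e) + e%:E; last by split.
rewrite -[leLHS]adde0 leeD ?lee_fin ?(ltW e0)// le_measure ?inE//.
  exact: borel_enlarge.
by move=> x Xx; apply/enlargeP; exists x => //; rewrite mdistxx.
Qed.

Lemma prohorov_dist_sym mu nu : prohorov_dist mu nu = prohorov_dist nu mu.
Proof.
by congr inf; apply/seteqP; split => d [d0 H]; split => // X /H[].
Qed.

Lemma prohorov_dist_triangle nu mu la :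
  (prohorov_dist mu la <= prohorov_dist mu nu + prohorov_dist nu la)%R.
Proof.
have half (a b c : borel_prob) d1 d2 X :
    prohorov_set a b d1 -> prohorov_set b c d2 -> borel_set X ->
    a X <= c (enlarge X (d1 + d2)) + (d1 + d2)%:E.
  move=> [d10 H1] [d20 H2] bX.
  rewrite (le_trans (proj1 (H1 _ bX)))// EFinD addeA [in leRHS]addeAC leeD//.
  rewrite (le_trans (proj1 (H2 _ (borel_enlarge _ _))))// leeD//.
  rewrite le_measure ?inE//; [exact: borel_enlarge|exact: borel_enlarge|].
  exact: enlarge_enlarge.
have sym a b d : prohorov_set a b d -> prohorov_set b a d.
  by move=> [d0 H]; split => // X /H[].
apply/ler_addgt0Pl => e e0.
have e20 : (0 < e / 2)%R by rewrite divr_gt0.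
have /prohorov_set_gt H1 : (prohorov_dist mu nu < prohorov_dist mu nu + e / 2)%R.
  by rewrite ltrDl.
have /prohorov_set_gt H2 : (prohorov_dist nu la < prohorov_dist nu la + e / 2)%R.
  by rewrite ltrDl.
rewrite [e]splitr addrC addrACA; apply: prohorov_set_ge.
split; first by rewrite addr_gt0// ltr_wpDl// prohorov_dist_ge0.
move=> X bX; split; first exact: half H1 H2 bX.
by rewrite addrC; exact: half (sym _ _ _ H2) (sym _ _ _ H1) bX.
Qed.

Lemma prohorov_dist_positivity mu nu : prohorov_dist mu nu = 0%R -> mu = nu.
Proof.
have half (a b : borel_prob) X : prohorov_dist a b = 0%R -> closed X -> a X <= b X.
  move=> ab0 cX.
  have inS n : prohorov_set a b (n.+1%:R^-1)%R.
    by apply: prohorov_set_gt; rewrite ab0 invr_gt0.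
  have bcvg : b (enlarge X (n.+1%:R^-1)%R) + (n.+1%:R^-1)%R%:E @[n --> \oo] --> b X.
    rewrite -[X in _ --> X]adde0; apply: cvgeD => //.
    - by rewrite fin_num_adde_defl.
    - rewrite -{2}(bigcap_enlarge_closed cX).
      apply: (@nonincreasing_cvg_mu _ _ _ b (fun n => enlarge X (n.+1%:R^-1)%R)).
      + by rewrite ltey_eq fin_num_measure//; exact: borel_enlarge.
      + by move=> n; exact: borel_enlarge.
      + by rewrite bigcap_enlarge_closed//; exact: borel_closed.
      + move=> m n mn; apply/subsetPset => x /enlargeP[y Xy xy].
        apply/enlargeP; exists y => //; apply: (lt_le_trans xy).
        by rewrite lef_pV2 ?posrE// ler_nat.
    - by apply/fine_cvgP; split; [exact: nearW|exact: cvg_harmonic].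
  apply: (cvge_ge _ bcvg); apply: nearW => n.
  by have [_ /(_ X (borel_closed cX))[]] := inS n.
move=> mn0; have nm0 : prohorov_dist nu mu = 0%R by rewrite prohorov_dist_sym.
have Hclosed X : closed X -> mu X = nu X.
  by move=> cX; apply/eqP; rewrite eq_le !half.
apply: borel_prob_eq => X bX.
apply: (@measure_unique _ R borel_type (@open T) (fun=> setT)) => //.
- by move=> A B; exact: openI.
- by move=> _; exact: openT.
- by rewrite bigcup_const//; exists 0%N.
- move=> A oA; have cA : closed (~` A) by exact: open_closedC.
  have C (a : borel_prob) : a A = 1 - a (~` A).
    by rewrite -[in LHS](setCK A); apply: probability_setC; exact: borel_closed.
  by apply: (etrans (C mu)); rewrite Hclosed//; exact/esym/C.
- by move=> _; rewrite -ge0_fin_numE// fin_num_measure.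
Qed.

HB.instance Definition _ := isMetric.Build R borel_prob
  prohorov_distxx prohorov_dist_positivity prohorov_dist_sym
  prohorov_dist_triangle.

End borel_probability.

Section induced_map.
Variables (R : realType) (T : pmetricType R) (f : T -> T).
Hypothesis cf : continuous f.
Local Open Scope ereal_scope.

Lemma borel_preimage X : borel_set X -> borel_set (f @^-1` X).
Proof.
have mf : measurable_fun setT (f : borel_type T -> borel_type T).
  apply: (@measurability _ _ (borel_type T) (borel_type T) setT f (@open T)) => //.
  move=> _ [B oB <-]; rewrite setTI; apply: borel_open.
  by move/continuousP : cf; apply.
by move=> bX; rewrite -[X in borel_set X]setTI; exact: mf.
Qed.

Section pushforward.
Variable mu : borel_prob T.

Definition induced_fun (X : set (borel_type T)) : \bar R :=
  if `[< borel_set X >] then mu (f @^-1` X) else 0.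

Lemma induced_funE X : borel_set X -> induced_fun X = mu (f @^-1` X).
Proof. by rewrite /induced_fun => bX; case: asboolP. Qed.

Let induced_fun0 : induced_fun set0 = 0.
Proof. by rewrite induced_funE ?preimage_set0 ?measure0//; exact: measurable0. Qed.

Let induced_fun_ge0 X : 0 <= induced_fun X.
Proof.
rewrite /induced_fun; case: asboolP => // bX; apply: measure_ge0.
Qed.

Let induced_fun_sigma_additive : semi_sigma_additive induced_fun.
Proof.
move=> F mF tF mUF; rewrite induced_funE// preimage_bigcup.
rewrite [X in X @ _ --> _](_ : _ =
  (fun n => \sum_(0 <= i < n) mu (f @^-1` F i))); last first.
  by apply/funext => n; apply: eq_bigr => i _; rewrite induced_funE//; exact: mF.
apply: (@measure_semi_sigma_additive _ _ _ mu (fun i => f @^-1` F i)).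
- by move=> n; apply: borel_preimage; exact: mF.
- apply/trivIsetP => /= i j _ _ ij; rewrite -preimage_setI.
  by move/trivIsetP : tF => /(_ _ _ _ _ ij) ->//; rewrite preimage_set0.
- by rewrite -preimage_bigcup; exact: borel_preimage.
Qed.

HB.instance Definition _ := isMeasure.Build _ (borel_type T) R induced_fun
  induced_fun0 induced_fun_ge0 induced_fun_sigma_additive.

Let induced_funT : induced_fun setT = 1.
Proof.
rewrite induced_funE; last exact: measurableT.
by rewrite preimage_setT; exact: (probability_setT mu).
Qed.

HB.instance Definition _ :=
  Measure_isProbability.Build _ (borel_type T) R induced_fun induced_funT.

Lemma induced_fun_off X : ~ borel_set X -> induced_fun X = 0.
Proof. by rewrite /induced_fun => bX; case: asboolP. Qed.

Definition induced : borel_prob T := BorelProb induced_fun_off.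

Lemma inducedE X : borel_set X -> induced X = mu (f @^-1` X).
Proof. exact: induced_funE. Qed.

End pushforward.
End induced_map.

(** The parameter R is only the field in which distances take their values. *)
Record cantor_homeo (R : realType) := CantorHomeo {
  homeo_val :> cantor_space -> cantor_space ;
  homeo_valP : is_homeo homeo_val }.

Section homeo_metric.
Variable R : realType.
Implicit Types f g h : cantor_homeo R.

HB.instance Definition _ := gen_eqMixin (cantor_homeo R).
HB.instance Definition _ := gen_choiceMixin (cantor_homeo R).

Lemma homeo_continuous h : continuous h.
Proof. by have [g []] := homeo_valP h. Qed.

(** The supremum is attained: see [homeo_dist_max]. *)
Definition homeo_dist f g : R := sup [set mdist (f x) (g x) | x in setT].

Lemma homeo_dist_has_sup f g : has_sup [set (mdist (f x) (g x) : R) | x in setT].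
Proof.
split; first by exists (mdist (f point) (g point)); exists point.
by exists 1 => _ [x _ <-]; exact: cantor_dist_le1.
Qed.

Lemma homeo_dist_ge f g x : mdist (f x) (g x) <= homeo_dist f g.
Proof.
by apply: ub_le_sup; [exact: (homeo_dist_has_sup f g).2|exists x].
Qed.

Lemma homeo_dist_le f g (d : R) :
  (forall x, mdist (f x) (g x) <= d) -> homeo_dist f g <= d.
Proof.
by move=> H; apply: ge_sup; [exact: (homeo_dist_has_sup f g).1|move=> _ [x _ <-]].
Qed.

Lemma homeo_dist_max f g : exists x, homeo_dist f g = mdist (f x) (g x).
Proof.
pose d x : R := mdist (f x) (g x).
have dc : continuous d.
  move=> x; apply/cvgrPdist_lt => e e0.
  have e20 : 0 < e / 2 by rewrite divr_gt0.
  have Fx := @homeo_continuous f x _ (nbhsx_ballx (f x) _ e20).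
  have Gx := @homeo_continuous g x _ (nbhsx_ballx (g x) _ e20).
  near=> y.
  have fxy : (mdist (f x) (f y) : R) < e / 2.
    have : ball (f x) (e / 2) (f y) by near: y; exact: Fx.
    by rewrite ballEmdist.
  have gxy : (mdist (g x) (g y) : R) < e / 2.
    have : ball (g x) (e / 2) (g y) by near: y; exact: Gx.
    by rewrite ballEmdist.
  have fyx : (mdist (f y) (f x) : R) < e / 2 by rewrite metric_sym.
  have gyx : (mdist (g y) (g x) : R) < e / 2 by rewrite metric_sym.
  have := metric_triangle (f y) (f x) (g y) : _ <= _ :> R.
  have := metric_triangle (f x) (g x) (g y) : _ <= _ :> R.
  have := metric_triangle (f x) (f y) (g x) : _ <= _ :> R.
  have := metric_triangle (f y) (g y) (g x) : _ <= _ :> R.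
  rewrite /d; move: fxy gxy fyx gyx => *.
  by rewrite ltr_norml; apply/andP; split; lra.
have [||c _ cmax] := @compact_EVT_max cantor_space R d setT _ cantor_space_compact.
- by exists point.
- by apply: continuous_subspaceT.
exists c; apply/eqP; rewrite eq_le homeo_dist_ge andbT; apply: homeo_dist_le => x.
by apply: cmax; rewrite inE.
Unshelve. all: by end_near. Qed.

Lemma homeo_distxx f : homeo_dist f f = 0.
Proof.
apply/eqP; rewrite eq_le homeo_dist_le/=; last by move=> x; rewrite mdistxx.
by rewrite (le_trans _ (homeo_dist_ge _ _ point))// mdist_ge0.
Qed.

Lemma homeo_dist_positivity f g : homeo_dist f g = 0 -> f = g.
Proof.
move=> fg0; have fg : homeo_val f = homeo_val g.
  apply/funext => x; apply: (@mdist_positivity R); apply/eqP.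
  by rewrite eq_le mdist_ge0 andbT -fg0 homeo_dist_ge.
case: f g {fg0} fg => f hf [g hg] /= fg; subst g.
by congr CantorHomeo; exact: Prop_irrelevance.
Qed.

Lemma homeo_dist_sym f g : homeo_dist f g = homeo_dist g f.
Proof.
by congr sup; apply/seteqP; split => _ [x _ <-]; exists x => //; exact: metric_sym.
Qed.

Lemma homeo_dist_triangle g f h :
  homeo_dist f h <= homeo_dist f g + homeo_dist g h.
Proof.
apply: homeo_dist_le => x; apply: le_trans (metric_triangle _ (g x) _) _.
by rewrite lerD// homeo_dist_ge.
Qed.

HB.instance Definition _ := isMetric.Build R (cantor_homeo R)
  homeo_distxx homeo_dist_positivity homeo_dist_sym homeo_dist_triangle.

End homeo_metric.

Definition homeo_induced (R : realType) (h : cantor_homeo R) :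
    borel_prob (cantor_space : pmetricType R) ->
    borel_prob (cantor_space : pmetricType R) :=
  @induced R cantor_space h (@homeo_continuous R h).

(* Main.v *)
(** Call a homeomorphism h graded at scale n if there are a Lyapunov function J, a
    phase I with I o h = I + 1 mod q, and an invariant function c, all locally
    constant, such that (J, I, c) determines the first n coordinates. This is an
    open condition, and a dense one: up to a change of coordinates any finite
    transition graph is also that of a map sending a repelling cycle through
    wandering sets to an attracting cycle. So the generic h is graded at all
    scales and for arbitrarily divisible q.

    If mu is nonwandering for the induced map, then J is mu-a.e. constant along
    orbits, hence h^q mu agrees with mu on the first n coordinates: mu is
    recurrent, and the averages of mu along h^q, which all agree with mu on these
    coordinates, have a limit which is a periodic point close to mu. A point
    where J strictly increases has no mass in a nonwandering measure, so adding a
    small Dirac mass there leaves the nonwandering set. An h^p-invariant measure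
    carried by a phase class modulo p has period exactly p, and mixing a small
    amount s of it into a periodic point mu gives the required periodic points
    for all but finitely many s. *)
Require Import Defs.
From mathcomp Require Import all_boot all_order all_algebra.
From mathcomp Require Import all_classical all_reals all_analysis.
From mathcomp Require Import zify lra.
From HB Require Import structures.
Import Order.TTheory GRing.Theory Num.Theory.
Import numFieldNormedType.Exports.

Set Implicit Arguments.
Unset Strict Implicit.
Unset Printing Implicit Defensive.

Local Open Scope classical_set_scope.

(** * Agreement on finitely many coordinates *)

Definition agree (n : nat) (x y : cantor_space) :=
  forall i, (i < n)%N -> x i = y i.

(** With [Y := Prop] this covers sets: a finitary set is a union of cylinders, hence clopen. *)
Definition finitary (n : nat) (Y : Type) (f : cantor_space -> Y) :=
  forall x y, agree n x y -> f x = f y.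

Definition ucont (f : cantor_space -> cantor_space) :=
  forall n, exists m, forall x y, agree m x y -> agree n (f x) (f y).

Lemma agree_sym n x y : agree n x y -> agree n y x.
Proof. by move=> xy i /xy ->. Qed.

Lemma agree_trans n x y z : agree n x y -> agree n y z -> agree n x z.
Proof. by move=> xy yz i im; rewrite xy// yz. Qed.

Lemma agree_le n m x y : (n <= m)%N -> agree m x y -> agree n x y.
Proof. by move=> nm xy i im; apply: xy; exact: leq_trans nm. Qed.

Lemma finitary_le n m Y (f : cantor_space -> Y) :
  (n <= m)%N -> finitary n f -> finitary m f.
Proof. by move=> nm ff x y /(agree_le nm)/ff. Qed.

Section cantor_topology.
Variable R : realType.

Lemma mdist_agree n (x y : cantor_space) :
  (mdist x y < n.+1%:R^-1 :> R)%R <-> agree n.+1 x y.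
Proof. exact: cantor_dist_ltP. Qed.

Lemma invS_lt (e : R) : (0 < e)%R -> exists n : nat, (n.+1%:R^-1 < e)%R.
Proof.
move=> e0; have [n _ /(_ n (leqnn n)) ?] := near_infty_natSinv_lt (PosNum e0).
by exists n.
Qed.

Lemma nbhs_agreeP (x : cantor_space) U :
  nbhs x U <-> exists n, forall y, agree n x y -> U y.
Proof.
split => [/(@nbhs_ballP R)[e /= /invS_lt[n ne] eU]|[n nU]].
  exists n.+1 => y /mdist_agree xy; apply: eU; rewrite ballEmdist/=.
  exact: lt_trans ne.
apply/(@nbhs_ballP R); exists n.+1%:R^-1%R; first by rewrite /= invr_gt0.
move=> y; rewrite ballEmdist/= => /mdist_agree xy; apply: nU.
exact: agree_le xy.
Qed.

(** Compactness of the Cantor space, in its near-covering form: it turns a number of coordinates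
    that works locally into one that works everywhere. *)
Lemma uniform_agree (Q : nat -> cantor_space -> Prop) :
  (forall n m x, (n <= m)%N -> Q n x -> Q m x) ->
  (forall x, exists n, forall y, agree n x y -> Q n y) ->
  exists n, forall x, Q n x.
Proof.
move=> Qmono Qloc.
have /compact_near_coveringP/(_ nat \oo Q _) := cantor_space_compact.
case => [x _|n _ /(_ n (leqnn n)) nQ].
  have [n nQ] := Qloc x.
  exists ([set y | agree n x y], [set m | (n <= m)%N]).
    by split; [apply/nbhs_agreeP; exists n|exists n].
  by move=> [y m] /= [/nQ ? nm]; exact: Qmono nm _.
by exists n => x; exact: nQ.
Qed.

Lemma pointwise_ucont f :
  (forall x n, exists m, forall y, agree m x y -> agree n (f x) (f y)) -> ucont f.
Proof.
move=> cf n.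
have [||m Hm] := @uniform_agree
  (fun m x => forall y, agree m x y -> agree n (f x) (f y)).
- by move=> k m x km H y /(agree_le km)/H.
- move=> x; have [m Hm] := cf x n; exists m => y xy z yz; apply: (@agree_trans _ _ (f x)).
    by apply: agree_sym; exact: Hm.
  by apply: Hm; exact: agree_trans yz.
- by exists m => x y /Hm.
Qed.

Lemma continuous_ucont f : continuous f -> ucont f.
Proof.
move=> cf; apply: pointwise_ucont => x n.
apply/nbhs_agreeP; apply: (cf x [set y | agree n (f x) y]).
by apply/nbhs_agreeP; exists n.
Qed.

Lemma ucont_continuous f : ucont f -> continuous f.
Proof.
move=> uf x U /nbhs_agreeP[n nU]; have [m Hm] := uf n.
by apply/nbhs_agreeP; exists m => y /Hm/nU.
Qed.

Lemma finitary_open n (A : set cantor_space) : finitary n A -> open A.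
Proof.
move=> fA; rewrite openE => x Ax; apply/nbhs_agreeP; exists n => y /fA.
by move=> <-.
Qed.

End cantor_topology.

(** * Homeomorphisms of the Cantor space *)

Section ucont_theory.
Variable R : realType.

Lemma ucont_id : ucont id. Proof. by move=> n; exists n. Qed.

Lemma ucont_comp f g : ucont f -> ucont g -> ucont (f \o g).
Proof.
move=> uf ug n; have [m fm] := uf n; have [k gk] := ug m.
by exists k => x y /gk/fm.
Qed.

Lemma ucont_iter f n : ucont f -> ucont (iter n f).
Proof.
move=> uf; elim: n => [|n IHn]; first exact: ucont_id.
exact: (ucont_comp uf IHn).
Qed.

Lemma finitary_comp n Y (l : cantor_space -> Y) f :
  finitary n l -> ucont f -> exists m, finitary m (l \o f).
Proof. by move=> fl /(_ n)[m fm]; exists m => x y /fm/fl. Qed.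

(** The label is constant near x, so only the branch [F (l x)] matters there; compactness makes the
    modulus uniform. This gives continuity of all piecewise definitions below. *)
Lemma ucont_cases Y n (l : cantor_space -> Y) (F : Y -> cantor_space -> cantor_space) :
  finitary n l -> (forall x, ucont (F (l x))) -> ucont (fun x => F (l x) x).
Proof.
move=> fl uF; apply: (pointwise_ucont R) => x k; have [m Fm] := uF x k.
exists (maxn n m) => y xy.
rewrite -(fl x y); first by apply: Fm; apply: agree_le xy; exact: leq_maxr.
by apply: agree_le xy; exact: leq_maxl.
Qed.

Definition bcons (b : bool) (x : cantor_space) : cantor_space :=
  fun i => if i is j.+1 then x j else b.

Definition btail (x : cantor_space) : cantor_space := fun i => x i.+1.

Lemma bconsK b : cancel (bcons b) btail. Proof. by []. Qed.

Lemma bcons_eta x : bcons (x 0%N) (btail x) = x.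
Proof. by apply/funext => -[]. Qed.

Lemma agree_bcons n b x y : agree n x y -> agree n.+1 (bcons b x) (bcons b y).
Proof. by move=> xy [|i] // /xy. Qed.

Lemma agree_btail n x y : agree n.+1 x y -> agree n (btail x) (btail y).
Proof. by move=> xy i im; apply: xy. Qed.

Lemma ucont_bcons b : ucont (bcons b).
Proof. by move=> n; exists n => x y /(@agree_bcons _ b); exact: agree_le. Qed.

Lemma ucont_btail : ucont btail.
Proof. by move=> n; exists n.+1 => x y /agree_btail. Qed.

Lemma finitary_head : finitary 1 (fun x => x 0%N).
Proof. by move=> x y; exact. Qed.

Definition cantor_copy (A : set cantor_space) :=
  exists f r : cantor_space -> cantor_space,
    [/\ ucont f, ucont r, forall x, A (f x), cancel f r &
        forall x, A x -> f (r x) = x].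

Lemma cantor_copyT : cantor_copy setT.
Proof. by exists id, id; split => //; exact: ucont_id. Qed.

(** Induction on n through the first bit. If only one half of A is nonempty, a copy of that half,
    prefixed by its bit, is a copy of A; if both are, the two halves of the space are sent to the
    two halves of A. *)
Lemma cantor_copy_finitary n A : finitary n A -> A !=set0 -> cantor_copy A.
Proof.
elim: n A => [|n IHn] A fA [a Aa].
  rewrite (_ : A = setT); first exact: cantor_copyT.
  by apply/seteqP; split => // x _; rewrite (fA x a).
have half b : bcons b @^-1` A !=set0 -> cantor_copy (bcons b @^-1` A).
  by apply: IHn => x y /(@agree_bcons _ b)/fA.
have [A0|A0] := pselect (bcons false @^-1` A !=set0); last first.
  have tA x : A x -> x 0%N = true.
    move=> Ax; case E : (x 0%N) => //; case: A0; exists (btail x).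
    by rewrite /= -E bcons_eta.
  have [|f [r [uf ur fA' fr rf]]] := half true.
    by exists (btail a); rewrite /= -(tA _ Aa) bcons_eta.
  exists (bcons true \o f), (r \o btail); split => //.
  - exact: ucont_comp (ucont_bcons _) uf.
  - exact: ucont_comp ur ucont_btail.
  - by move=> x Ax /=; rewrite rf /= -(tA _ Ax) bcons_eta.
have [A1|A1] := pselect (bcons true @^-1` A !=set0); last first.
  have tA x : A x -> x 0%N = false.
    move=> Ax; case E : (x 0%N) => //; case: A1; exists (btail x).
    by rewrite /= -E bcons_eta.
  have [|f [r [uf ur fA' fr rf]]] := half false.
    by exists (btail a); rewrite /= -(tA _ Aa) bcons_eta.
  exists (bcons false \o f), (r \o btail); split => //.
  - exact: ucont_comp (ucont_bcons _) uf.
  - exact: ucont_comp ur ucont_btail.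
  - by move=> x Ax /=; rewrite rf /= -(tA _ Ax) bcons_eta.
have [f0 [r0 [uf0 ur0 fA0 fr0 rf0]]] := half _ A0.
have [f1 [r1 [uf1 ur1 fA1 fr1 rf1]]] := half _ A1.
pose F (b : bool) := bcons b \o (if b then f1 else f0) \o btail.
pose G (b : bool) := bcons b \o (if b then r1 else r0) \o btail.
have uF b : ucont (F b).
  rewrite /F; apply: (ucont_comp _ ucont_btail).
  by apply: (ucont_comp (ucont_bcons _)); case: b.
have uG b : ucont (G b).
  rewrite /G; apply: (ucont_comp _ ucont_btail).
  by apply: (ucont_comp (ucont_bcons _)); case: b.
exists (fun x => F (x 0%N) x), (fun x => G (x 0%N) x); split.
- exact: ucont_cases finitary_head _.
- exact: ucont_cases finitary_head _.
- by move=> x; rewrite /F /=; case: (x 0%N); [exact: fA1|exact: fA0].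
- move=> x; rewrite -[RHS]bcons_eta; congr bcons; rewrite /F /G /=.
  by case: (x 0%N); [exact: (fr1 (btail x))|exact: (fr0 (btail x))].
- move=> x; rewrite -[in A x](bcons_eta x) -[RHS]bcons_eta => Ax.
  congr bcons; rewrite /F /G /=; move: Ax.
  by case: (x 0%N) => Ax; [exact: (rf1 (btail x))|exact: (rf0 (btail x))].
Qed.

(** Over each common label the fibres of [l1] and [l2] are nonempty and finitary, hence both copies
    of the Cantor space; identify them fibre by fibre. *)
Lemma glue_finitary Y n (l1 l2 : cantor_space -> Y) :
  finitary n l1 -> finitary n l2 -> range l1 = range l2 ->
  exists f g, [/\ ucont f, ucont g, cancel f g, cancel g f &
    forall x, l2 (f x) = l1 x].
Proof.
move=> fl1 fl2 l12.
have copies (l : cantor_space -> Y) : finitary n l -> exists fr :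
    Y -> (cantor_space -> cantor_space) * (cantor_space -> cantor_space),
    forall y, range l y -> [/\ ucont (fr y).1, ucont (fr y).2,
      forall x, l ((fr y).1 x) = y, cancel (fr y).1 (fr y).2 &
      forall x, l x = y -> (fr y).1 ((fr y).2 x) = x].
  move=> fl; suff : forall y, exists fr :
    (cantor_space -> cantor_space) * (cantor_space -> cantor_space),
    range l y -> [/\ ucont fr.1, ucont fr.2, forall x, l (fr.1 x) = y,
      cancel fr.1 fr.2 & forall x, l x = y -> fr.1 (fr.2 x) = x].
    by move=> /choice[fr ?]; exists fr.
  move=> y.
  have [yl|nyl] := pselect (range l y); last by exists (id, id).
  have [||f [r H]] := @cantor_copy_finitary n [set x | l x = y].
  - by move=> x z /fl /= ->.
  - by case: yl => x _ <-; exists x.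
  - by exists (f, r).
have [c1 H1] := copies _ fl1; have [c2 H2] := copies _ fl2.
have r1 x : range l1 (l1 x) by exists x.
have r2 x : range l2 (l2 x) by exists x.
have r12 x : range l2 (l1 x) by rewrite -l12.
have r21 x : range l1 (l2 x) by rewrite l12.
have l2f x : l2 ((c2 (l1 x)).1 ((c1 (l1 x)).2 x)) = l1 x.
  by have [_ _ ->] := H2 _ (r12 x).
have l1g x : l1 ((c1 (l2 x)).1 ((c2 (l2 x)).2 x)) = l2 x.
  by have [_ _ ->] := H1 _ (r21 x).
exists (fun x => (c2 (l1 x)).1 ((c1 (l1 x)).2 x)).
exists (fun x => (c1 (l2 x)).1 ((c2 (l2 x)).2 x)); split => //.
- apply: (ucont_cases (F := fun y x => (c2 y).1 ((c1 y).2 x))) fl1 _ => x.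
  have [u _ _ _ _] := H2 _ (r12 x); have [_ v _ _ _] := H1 _ (r1 x).
  exact: ucont_comp u v.
- apply: (ucont_cases (F := fun y x => (c1 y).1 ((c2 y).2 x))) fl2 _ => x.
  have [u _ _ _ _] := H1 _ (r21 x); have [_ v _ _ _] := H2 _ (r2 x).
  exact: ucont_comp u v.
- move=> x; rewrite l2f.
  have [_ _ _ -> _] := H2 _ (r12 x); have [_ _ _ _ ->//] := H1 _ (r1 x).
- move=> x; rewrite l1g.
  have [_ _ _ -> _] := H1 _ (r21 x); have [_ _ _ _ ->//] := H2 _ (r2 x).
Qed.

End ucont_theory.

(** * Density of graded homeomorphisms *)

Section transit.
Variable R : realType.

(* A map moving 0^k 1y one step away from the repelling fixed point 0^oo, and
   1^k 0y one step closer to the attracting fixed point 1^oo. *)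
Definition push (x : cantor_space) : cantor_space :=
  if x 0%N then bcons true x
  else if x 1%N then bcons true (bcons false (btail (btail x))) else btail x.

Definition pull (x : cantor_space) : cantor_space :=
  if x 0%N then
    if x 1%N then btail x else bcons false (bcons true (btail (btail x)))
  else bcons false x.

Lemma pushK : cancel push pull.
Proof.
move=> x; rewrite /push; case x0 : (x 0%N).
  by rewrite /pull /= x0 bconsK.
case x1 : (x 1%N).
  rewrite /pull /=; apply/funext => -[|[|i]] //=.
by rewrite /pull /btail x1 -/(btail x) -[in RHS](bcons_eta x) x0.
Qed.

Lemma pullK : cancel pull push.
Proof.
move=> x; rewrite /pull; case x0 : (x 0%N); last first.
  by rewrite /push /= x0 bconsK.
case x1 : (x 1%N); last first.
  by rewrite /push /=; apply/funext => -[|[|i]] //=.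
by rewrite /push /btail x1 -/(btail x) -[in RHS](bcons_eta x) x0.
Qed.

Lemma finitary_coord i : finitary i.+1 (fun x => x i).
Proof. by move=> x y; apply. Qed.

Lemma ucont_push : ucont push.
Proof.
apply: (ucont_cases R (l := fun x => x 0%N) (F := fun b x =>
  if b then bcons true x else if x 1%N then
  bcons true (bcons false (btail (btail x))) else btail x)) finitary_head _ => x.
case: (x 0%N) => /=; first exact: ucont_bcons.
apply: (ucont_cases R (l := fun x => x 1%N) (F := fun b x => if b then
  bcons true (bcons false (btail (btail x))) else btail x)) (@finitary_coord 1) _ => y.
case: (y 1%N); last exact: ucont_btail.
apply: (ucont_comp (ucont_bcons true)).
apply: (ucont_comp (ucont_bcons false)).
exact: ucont_comp ucont_btail ucont_btail.
Qed.

Lemma ucont_pull : ucont pull.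
Proof.
apply: (ucont_cases R (l := fun x => x 0%N) (F := fun b x =>
  if b then if x 1%N then btail x else
  bcons false (bcons true (btail (btail x))) else bcons false x)) finitary_head _ => x.
case: (x 0%N) => /=; last exact: ucont_bcons.
apply: (ucont_cases R (l := fun x => x 1%N) (F := fun b x => if b then btail x else
  bcons false (bcons true (btail (btail x))))) (@finitary_coord 1) _ => y.
case: (y 1%N); first exact: ucont_btail.
apply: (ucont_comp (ucont_bcons false)).
apply: (ucont_comp (ucont_bcons true)).
exact: ucont_comp ucont_btail ucont_btail.
Qed.

Fixpoint run (b : bool) (M : nat) (x : cantor_space) : nat :=
  if M is M'.+1 then if x 0%N == b then (run b M' (btail x)).+1 else 0%N else 0%N.

Lemma finitary_run b M : finitary M (run b M).
Proof.
elim: M => //= M IHM x y xy; rewrite -(xy 0%N)//.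
by rewrite (IHM _ (btail y))//; exact: agree_btail.
Qed.

Lemma run_le b M x : (run b M x <= M)%N.
Proof. by elim: M x => //= M IHM x; case: ifP => // _; rewrite ltnS. Qed.

Lemma run_minn b M x : run b M x = minn (run b M.+1 x) M.
Proof.
elim: M x => [|M IHM] x; first by rewrite minn0.
rewrite [LHS]/= IHM [in RHS]/= -/(run b M.+1 _); case: ifP => _; lia.
Qed.

(* The number of steps already made by [x] from 0^oo to 1^oo, truncated at both
   ends so that it depends on finitely many coordinates. *)
Definition level (M : nat) (x : cantor_space) : nat :=
  if x 0%N then (M + run true M.+1 x)%N else (M.+1 - run false M.+1 x)%N.

Lemma finitary_level M : finitary M.+1 (level M).
Proof. by move=> x y xy; rewrite /level -(xy 0%N)// !(finitary_run _ xy). Qed.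

Lemma level_le M x : (level M x <= M + M.+1)%N.
Proof.
by rewrite /level; case: ifP => _; have := run_le true M.+1 x; lia.
Qed.

(** One case per branch of [push]: an initial run of 1 grows, 01 becomes 10 in passing from level M
    to M+1, an initial run of 0 shrinks. Only the truncation, at 0 and at 2M+1, can hold the level
    still. *)
Lemma level_push M x :
  (level M (push x) = (level M x).+1 /\ (level M x < M + M.+1)%N) \/
  (level M (push x) = level M x /\ (level M x = 0%N \/ level M x = (M + M.+1)%N)).
Proof.
rewrite /push; case x0 : (x 0%N).
  rewrite /level /= x0 /=.
  have := run_minn true M x; have := run_le true M.+1 x; rewrite /= x0 /=.
  have -> : btail (bcons true x) = x by [].
  by move: (run _ _ _) (run _ _ _) => a b; lia.
case x1 : (x 1%N).
  left; rewrite /level /= x0 /=.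
  have r b z : z 0%N = ~~ b -> run b M z = 0%N.
    by case: (M) => //= M' ->; case: b.
  by rewrite !r//; lia.
have -> : level M (btail x) = (M.+1 - run false M.+1 (btail x))%N.
  by rewrite /level {1}/btail x1.
have -> : level M x = (M.+1 - (run false M (btail x)).+1)%N.
  by rewrite /level x0 /= x0.
have := run_minn false M (btail x); have := run_le false M.+1 (btail x).
have : (0 < run false M.+1 (btail x))%N by rewrite /= /btail x1.
by move: (run _ M _) (run _ M.+1 _) => ? ?; lia.
Qed.

Lemma level_hit M t : (t < M + M.+1)%N ->
  exists x, level M x = t /\ level M (push x) = t.+1.
Proof.
have rle k N : run false N (fun i => (k <= i)%N) = minn k N.
  elim: N k => [|N IHN] k; first by rewrite minn0.
  case: k => [|k] /=; first by rewrite min0n.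
  by rewrite (_ : btail _ = (fun i => (k <= i)%N))// IHN; lia.
(* The point 0^(M+1) 1^oo has level 0 but leaves it at once; from then on [level_push] forces its
   orbit up through every level. *)
pose x0 : cantor_space := fun i => (M.+1 <= i)%N.
have l0 : level M x0 = 0%N by rewrite /level rle /=; lia.
have l1 : level M (push x0) = 1%N.
  rewrite /push /=; case: ifP => [|_].
    rewrite /x0; case: (M) => // _; rewrite /level /=; lia.
  rewrite /level (_ : btail x0 = (fun i => (M <= i)%N))//.
  case: ifP => [|_]; last by rewrite rle; lia.
  by case: M @x0 l0 => // ; rewrite /=.
suff H : forall s, (s < M + M.+1)%N -> level M (iter s push x0) = s /\
    level M (push (iter s push x0)) = s.+1.
  by move=> /H ?; exists (iter t push x0).
elim=> [|s IHs] // ts; have [_ e] := IHs (ltnW ts).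
split=> //; rewrite /= .
have := level_push M (push (iter s push x0)); rewrite e; lia.
Qed.

End transit.

(** * Splitting the Cantor space into finitely many copies of itself *)

Section coding.
Variable R : realType.

(** A prefix code: the element of rank i has prefix 1^i 0, except the last one, whose prefix is 1^i
    alone. [idx] reads the prefix and [pay] the rest. *)
Lemma finite_coding (F : finType) (f0 : F) :
  exists (enc : F -> cantor_space -> cantor_space) (idx : cantor_space -> F)
    (pay : cantor_space -> cantor_space),
  [/\ forall f, ucont (enc f), exists m, finitary m idx, ucont pay,
      forall f x, idx (enc f x) = f /\ pay (enc f x) = x &
      forall x, enc (idx x) (pay x) = x].
Proof.
suff [enc [idx [pay [uenc [m fidx] upay idxle decK]]]] :
    exists (enc : nat -> cantor_space -> cantor_space) (idx : cantor_space -> nat)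
    (pay : cantor_space -> cantor_space),
    [/\ forall i, ucont (enc i), exists m, finitary m idx, ucont pay,
      forall x, (idx x < #|F|)%N &
      (forall i x, (i < #|F|)%N -> idx (enc i x) = i /\ pay (enc i x) = x) /\
      forall x, enc (idx x) (pay x) = x].
  exists (fun f => enc (enum_rank f)), (fun x => enum_val (Ordinal (idxle x))), pay.
  case: decK => decK1 decK2; split.
  - by move=> f.
  - exists m => x y xy; congr enum_val; apply: val_inj => /=; exact: fidx.
  - by [].
  - move=> f x; have [e1 e2] := decK1 (enum_rank f) x (ltn_ord _).
    by split => //; apply: enum_rank_inj; rewrite enum_valK; apply: val_inj.
  - by move=> x; rewrite enum_valK; exact: decK2.
have : (0 < #|F|)%N by apply/card_gt0P; exists f0.
elim: #|F| => // -[|k] IHk _.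
  have uid := ucont_id; exists (fun _ => id), (fun=> 0%N), id; split => //.
  - by exists 0%N.
  - by split => // -[].
have [//|enc [idx [pay [uenc [m fidx] upay idxle [encK decK]]]]] := IHk.
exists (fun i => if i is j.+1 then bcons true \o enc j else bcons false).
exists (fun x => if x 0%N then (idx (btail x)).+1 else 0%N).
exists (fun x => if x 0%N then pay (btail x) else btail x); split.
- by case=> [|i]; [exact: ucont_bcons|exact: ucont_comp (ucont_bcons _) (uenc i)].
- exists m.+1 => x y xy; rewrite -(xy 0%N)//.
  by rewrite (fidx _ (btail y))//; exact: agree_btail.
- apply: (ucont_cases R (l := fun x => x 0%N) (F := fun b x =>
    if b then pay (btail x) else btail x)) finitary_head _ => x.
  by case: (x 0%N) => /=; [exact: ucont_comp upay ucont_btail|exact: ucont_btail].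
- by move=> x; case: ifP => // _; rewrite ltnS.
- split.
  + case=> [|i] x //=; rewrite ltnS => /(encK _ x)[e1 e2].
    by rewrite (_ : btail _ = enc i x)// e1 e2.
  + move=> x; rewrite -[RHS]bcons_eta; case: (x 0%N) => //.
    exact: (congr1 (bcons true) (decK (btail x))).
Qed.

End coding.

(** * Walks in a finite graph, periodic at both ends *)

Section walks.
Local Open Scope nat_scope.
Variable T : finType.

(** By pigeonhole the orbit enters a cycle within [#|T|] steps, and the length of the cycle, being
    at most [#|T|], divides the factorial. *)
Lemma iter_fact_period (f : T -> T) (d a : nat) (x : T) :
  #|T| <= a -> iter (a + d * (#|T|)`!) f x = iter a f x.
Proof.
move=> Ta.
have [i [j [ij jT fij]]] : exists i j, [/\ i < j, j <= #|T| & iter i f x = iter j f x].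
  pose g (i : 'I_#|T|.+1) := iter i f x.
  have /injectivePn[i [j ij gij]] : ~~ injectiveb g.
    by apply/injectiveP => /leq_card; rewrite card_ord ltnn.
  have [lt|lt|/val_inj ji] := ltngtP i j.
  - by exists i, j; split => //; rewrite -ltnS; exact: ltn_ord.
  - by exists j, i; split => //; rewrite -ltnS; exact: ltn_ord.
  - by rewrite ji eqxx in ij.
have step b : i <= b -> iter (b + (j - i)) f x = iter b f x.
  move=> ib; have -> : b + (j - i) = (b - i) + j by lia.
  by rewrite iterD -fij -iterD subnK.
have steps k b : i <= b -> iter (b + k * (j - i)) f x = iter b f x.
  move=> ib; elim: k => [|k IHk]; first by rewrite addn0.
  by rewrite mulSn addnCA addnC step//; lia.
have /dvdnP[k ->] : j - i %| (#|T|)`! by apply: dvdn_fact; lia.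
by rewrite mulnA steps//; lia.
Qed.

Variable G : T -> T -> Prop.
Hypothesis Gsucc : forall a, exists b, G a b.
Hypothesis Gpred : forall b, exists a, G a b.

Lemma periodic_walk (d : nat) : 0 < d -> exists q, [/\ 0 < q, d %| q &
  exists K0, forall K, K0 <= K -> forall a b, G a b -> exists w : nat -> T,
    [/\ forall t, G (w t) (w t.+1), w q = w 0, w (K + q) = w K &
        exists t, [/\ 0 < t, t < K, w t = a & w t.+1 = b]]].
Proof.
move=> d0; have [s Gs] := choice Gsucc; have [p Gp] := choice Gpred.
pose q := d * (#|T|)`!; exists q; split; rewrite ?muln_gt0 ?d0 ?fact_gt0//.
  exact: dvdn_mulr.
(* The edge is crossed at time B. Times 0 and q lie at least [#|T|] steps before B, and K at least
   [#|T|] steps after B+1. *)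
pose B := #|T| + q + 1; exists (B + #|T| + 1) => K KB a b Gab.
exists (fun t => if t <= B then iter (B - t) p a else iter (t - B.+1) s b); split.
- move=> t; have [tB|tB|->] := ltngtP t B.
  + by rewrite (_ : B - t = (B - t.+1).+1); [exact: Gp|lia].
  + by rewrite (_ : t.+1 - B.+1 = (t - B.+1).+1); [exact: Gs|lia].
  + by rewrite !subnn.
- rewrite leq0n ifT; last by rewrite /B; lia.
  rewrite (_ : B - 0 = (B - q) + q); last by rewrite /B; lia.
  by rewrite iter_fact_period// /B; lia.
- rewrite !ifF; try by apply/negbTE; rewrite -ltnNge; lia.
  rewrite (_ : K + q - B.+1 = (K - B.+1) + q); last lia.
  by rewrite iter_fact_period//; lia.
- by exists B; rewrite leqnn ltnn !subnn; split => //; rewrite /B; lia.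
Qed.

End walks.

(** This plays the role of a partition of mesh at most [1 / n] whose transition
    graph is a union of dumbbells with loops of length [q]: [c] numbers the
    dumbbells, [J] the positions on the bar and [I] the positions on the loops. *)
Definition graded (n d : nat) (h : cantor_space -> cantor_space) :=
  exists (m q K : nat) (J I c : cantor_space -> nat),
  [/\ [/\ (0 < q)%N, (d %| q)%N, finitary m J, finitary m I & finitary m c],
      [/\ forall x, (J x <= K)%N, forall x, (J x <= J (h x))%N,
          forall x, I (h x) = (I x).+1 %[mod q] & forall x, c (h x) = c x],
      forall x y, J x = J y -> I x = I y %[mod q] -> c x = c y -> agree n x y,
      exists x, (J x < J (h x))%N &
      exists x y, c x <> c y].

(** The conditions involve h only through the values of [J], [I] and [c] at h x, and these depend on
    m coordinates. *)
Lemma graded_open n d h : graded n d h ->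
  exists m, forall h', (forall x, agree m (h x) (h' x)) -> graded n d h'.
Proof.
move=> [m [q [K [J [I [c [[q0 dq fJ fI fc] [JK Jh Ih ch] JIc [x Jx] cc]]]]]]].
exists m => h' hh'; exists m, q, K, J, I, c; split => //.
- by split => // y; rewrite -?(fJ _ _ (hh' y)) -?(fI _ _ (hh' y)) -?(fc _ _ (hh' y)).
- by exists x; rewrite -(fJ _ _ (hh' x)).
Qed.

(** * Approximation by a conjugate of a model map *)

Section density.
Local Open Scope nat_scope.
Variable R : realType.

Definition word n (x : cantor_space) : {ffun 'I_n -> bool} := [ffun i => x (val i)].

Lemma word_agree n x y : word n x = word n y <-> agree n x y.
Proof.
split => [/ffunP xy i im|xy]; first by have := xy (Ordinal im); rewrite !ffunE.
by apply/ffunP => i; rewrite !ffunE; apply: xy; exact: ltn_ord.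
Qed.

Lemma word_surj n (w : {ffun 'I_n -> bool}) : exists x, word n x = w.
Proof.
exists (fun i => if insub i is Some j then w j else false).
by apply/ffunP => i; rewrite ffunE valK.
Qed.

Lemma finitary_word n : finitary n (word n).
Proof. by move=> x y /word_agree. Qed.

(* [phase q' j i] is the representative of [i - j] modulo [q'.+1]: the orbit
   with phase [i] at level [j] is at position [j + phase q' j i] of its walk. *)
Let phase q' j i := (i + j * q') %% q'.+1.

Let phase_step q' j i : phase q' j.+1 (i.+1 %% q'.+1) = phase q' j i.
Proof.
by rewrite /phase modnDml (_ : i.+1 + _ = i + j * q' + q'.+1) ?modnDr//; lia.
Qed.

Let phase_stay q' j i : phase q' j (i.+1 %% q'.+1) = (phase q' j i).+1 %% q'.+1.
Proof. by rewrite /phase modnDml -[in RHS]addn1 modnDml addn1 addSn. Qed.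

Let phase0 q' j : phase q' j (j %% q'.+1) = 0.
Proof. by rewrite /phase modnDml -mulnS ?modnMl ?modnMr. Qed.

(* The model [g] acts on triples (e, i, z), with e an edge of the transition graph
   of [h] on words of length [n.+1], i a phase and z a point moved by [push]; the
   label of a triple follows a walk through e which is periodic near both ends,
   so the model and [h] have the same set of label transitions and [g] can be
   conjugated into a map agreeing with [h] on the first [n.+1] coordinates. *)
Lemma graded_dense n d h hi : 0 < d -> ucont h -> cancel h hi -> cancel hi h ->
  exists h' hi', [/\ ucont h', ucont hi', cancel h' hi', cancel hi' h' &
    (forall x, agree n.+1 (h' x) (h x)) /\ graded n.+1 d h'].
Proof.
move=> d0 uh hK hiK.
pose W := {ffun 'I_n.+1 -> bool}.
pose G (a b : W) := exists x, word n.+1 x = a /\ word n.+1 (h x) = b.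
have Gs a : exists b, G a b.
  by have [x <-] := word_surj a; exists (word n.+1 (h x)), x.
have Gp b : exists a, G a b.
  have [x <-] := word_surj b; exists (word n.+1 (hi x)), (hi x).
  by rewrite hiK.
have [q1 [q_gt0 dq [M walkM]]] := periodic_walk Gs Gp d0.
case: q1 q_gt0 dq walkM => // q' _ dq walkM.
pose K := M + M.+1; pose q := q'.+1.
have [w Hw] : exists w : W * W -> nat -> W, forall e,
    [/\ forall t, G (w e t) (w e t.+1), w e q = w e 0, w e (K + q) = w e K &
      G e.1 e.2 -> exists t, [/\ t < K, w e t = e.1 & w e t.+1 = e.2]].
  suff : forall e : W * W, exists w : nat -> W,
    [/\ forall t, G (w t) (w t.+1), w q = w 0, w (K + q) = w K &
      G e.1 e.2 -> exists t, [/\ t < K, w t = e.1 & w t.+1 = e.2]].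
    by move=> /choice[w ?]; exists w.
  have MK : M <= K by rewrite /K; lia.
  move=> e; have [Ge|nGe] := pselect (G e.1 e.2).
    have [w [w1 w2 w3 [t [t0 tK ta tb]]]] := walkM _ MK _ _ Ge.
    by exists w; split => // _; exists t.
  (* A pair that is not an edge receives a walk through an arbitrary edge, so that every triple has
     a label. *)
  have [b Gb] := Gs (word n.+1 point).
  by have [w [w1 w2 w3 _]] := walkM _ MK _ _ Gb; exists w; split.
pose F := ((W * W) * 'I_q)%type.
pose wc b : W := [ffun=> b].
have [enc [idx [pay [uenc [mi fidx] upay encK decK]]]] :=
  finite_coding R (((wc true, wc true), ord0) : F).
pose rot (f : F) : F := (f.1, ordS f.2); pose rotV (f : F) : F := (f.1, ord_pred f.2).
pose g x := enc (rot (idx x)) (push (pay x)).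
pose gi x := enc (rotV (idx x)) (pull (pay x)).
have gK : cancel g gi.
  move=> x; rewrite /gi /g; have [-> ->] := encK (rot (idx x)) (push (pay x)).
  by rewrite pushK -[RHS]decK; congr enc; rewrite /rotV /rot /= ordSK -surjective_pairing.
have giK : cancel gi g.
  move=> x; rewrite /gi /g; have [-> ->] := encK (rotV (idx x)) (pull (pay x)).
  by rewrite pullK -[RHS]decK; congr enc; rewrite /rotV /rot /= ord_predK -surjective_pairing.
have ug : ucont g.
  apply: (ucont_cases R (l := idx) (F := fun f x => enc (rot f) (push (pay x)))) fidx _ => x.
  exact: ucont_comp (uenc _) (ucont_comp (ucont_push R) upay).
have ugi : ucont gi.
  apply: (ucont_cases R (l := idx) (F := fun f x => enc (rotV f) (pull (pay x)))) fidx _ => x.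
  exact: ucont_comp (uenc _) (ucont_comp (ucont_pull R) upay).
pose lev x := level M (pay x).
pose lab x := w (idx x).1 (lev x + phase q' (lev x) (idx x).2).
have idxg x : idx (g x) = rot (idx x) by have [] := encK (rot (idx x)) (push (pay x)).
have levg x : lev (g x) = level M (push (pay x)).
  by rewrite /lev; have [_ ->] := encK (rot (idx x)) (push (pay x)).
(* While the level rises the offset [phase] is unchanged and the walk advances by one. At the end
   levels 0 and K the offset turns modulo q, around a loop that closes because w q = w 0 and w (K +
   q) = w K. *)
have Glab x : G (lab x) (lab (g x)).
  have [wG w0 wK _] := Hw (idx x).1.
  rewrite /lab idxg levg /=.
  have [[-> _]|[-> l0K]] := level_push M (pay x); rewrite -/(lev x).
    by rewrite phase_step addSn; exact: wG.
  rewrite phase_stay; set k := phase _ _ _.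
  have : k < q by rewrite ltn_mod.
  rewrite leq_eqVlt => /predU1P[kq|kq].
    rewrite kq modnn addn0.
    have <- : w (idx x).1 (lev x + q) = w (idx x).1 (lev x).
      by case: l0K; rewrite -/(lev x) => ->.
    by rewrite -[in X in G _ (_ _ X)]kq addnS; exact: wG.
  by rewrite modn_small// addnS; exact: wG.
have [ml flev] : exists m, finitary m lev.
  exact: finitary_comp (finitary_level (M := M)) upay.
have flab : finitary (maxn mi ml) lab.
  move=> x y xy; have ei : idx x = idx y.
    by apply: fidx; apply: agree_le xy; exact: leq_maxl.
  have el : lev x = lev y.
    by apply: flev; apply: agree_le xy; exact: leq_maxr.
  by rewrite /lab ei el.
(* Matching pairs of consecutive labels makes the conjugate of [g] follow h: the second components
   say that the images of x under the two maps begin with the same word. *)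
pose l1 x := (word n.+1 x, word n.+1 (h x)).
pose l2 x := (lab x, lab (g x)).
have [m1 fl1] : exists m, finitary m l1.
  have [m fm] := finitary_comp (finitary_word (n := n.+1)) uh.
  exists (maxn n.+1 m) => x y xy; congr pair.
    by apply: finitary_word; apply: agree_le xy; exact: leq_maxl.
  by apply: fm; apply: agree_le xy; exact: leq_maxr.
have [m2 fl2] : exists m, finitary m l2.
  have [m fm] := finitary_comp flab ug.
  exists (maxn (maxn mi ml) m) => x y xy; congr pair.
    by apply: flab; apply: agree_le xy; exact: leq_maxl.
  by apply: fm; apply: agree_le xy; exact: leq_maxr.
have l12 : range l1 = range l2.
  apply/seteqP; split => _ [x _ <-]; last first.
    by have [y [y1 y2]] := Glab x; exists y => //; rewrite /l1 /l2 y1 y2.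
  have [_ _ _ []] := Hw (l1 x); first by exists x.
  move=> t [tK wa wb]; have [z [zt zt1]] := level_hit tK.
  (* Phase t mod q has offset 0 at level t, so this triple stands on its walk exactly at time t. *)
  exists (enc (l1 x, inord (t %% q)) z) => //.
  have [e1 e2] := encK (l1 x, inord (t %% q)) z.
  have ti : (inord (t %% q) : 'I_q) = t %% q :> nat by rewrite inordK// ltn_mod.
  rewrite /l2 /lab idxg levg /lev e1 e2 zt zt1 /=.
  by rewrite phase_step ti phase0 !addn0 wa wb.
have [f [fi [uf ufi fK fiK lf]]] := glue_finitary R
  (finitary_le (leq_maxl m1 m2) fl1) (finitary_le (leq_maxr m1 m2) fl2) l12.
have wlab x : word n.+1 x = lab (f x) by have [] := lf x.
exists (fi \o g \o f), (fi \o gi \o f); split.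
- exact: ucont_comp (ucont_comp ufi ug) uf.
- exact: ucont_comp (ucont_comp ufi ugi) uf.
- by move=> x /=; rewrite fiK gK fK.
- by move=> x /=; rewrite fiK giK fK.
split.
  move=> x; apply/word_agree; rewrite wlab /= fiK.
  by have [_ ->] := lf x.
have [m1' flevf] := finitary_comp flev uf.
have [m2' fidxf] := finitary_comp fidx uf.
pose m := maxn m1' m2'.
exists m, q, K, (lev \o f), (fun x => val (idx (f x)).2).
exists (fun x => val (enum_rank (idx (f x)).1)).
have fl : finitary m (lev \o f) := finitary_le (leq_maxl _ _) flevf.
have fi' : finitary m (idx \o f) := finitary_le (leq_maxr _ _) fidxf.
have ff x : f ((fi \o g \o f) x) = g (f x) by rewrite /= fiK.
split.
- split => //.
  + by move=> x y /fi' /= ->.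
  + by move=> x y /fi' /= ->.
- split => x.
  + exact: level_le.
  + rewrite /= -/((fi \o g \o f) x) ff levg.
    by have [[-> _]|[-> _]] := level_push M (pay (f x)); rewrite /lev; lia.
  + by rewrite ff idxg /= modn_mod.
  + by rewrite ff idxg.
- move=> x y /= el; rewrite !modn_small ?ltn_ord// => ei ec.
  apply/word_agree; rewrite !wlab /lab el.
  by rewrite (enum_rank_inj (val_inj ec)) ei.
- have [|z [z0 z1]] := @level_hit M 0; first by lia.
  exists (fi (enc ((wc true, wc true), ord0) z)).
  rewrite /= !fiK levg /lev.
  by have [_ ->] := encK ((wc true, wc true), ord0) z; rewrite z0 z1.
- exists (fi (enc ((wc true, wc true), ord0) point)).
  exists (fi (enc ((wc false, wc false), ord0) point)); rewrite !fiK.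
  have [-> _] := encK ((wc true, wc true), ord0) point.
  have [-> _] := encK ((wc false, wc false), ord0) point.
  by move=> /= /val_inj/enum_rank_inj[/ffunP/(_ ord0)]; rewrite !ffunE.
Qed.

End density.

Local Open Scope ring_scope.

(** * Borel probability measures on the Cantor space *)

Section borel_prob_of.
Variables (R : realType) (T : pmetricType R) (m : set (borel_type T) -> \bar R).
Hypotheses (m0 : m set0 = 0%E) (m_ge0 : forall X, (0 <= m X)%E)
  (m_sigma : semi_sigma_additive m) (mT : m setT = 1%E).
Local Open Scope ereal_scope.

(** [borel_prob] demands the value 0 off the Borel sets, so m is cut off there before being
    packaged. *)
Let r (X : set (borel_type T)) : \bar R := if `[< borel_set X >] then m X else 0.

Let rE X : borel_set X -> r X = m X.
Proof. by rewrite /r => bX; case: asboolP. Qed.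

Let r0 : r set0 = 0.
Proof. by rewrite rE //; exact: measurable0. Qed.

Let r_ge0 X : 0 <= r X. Proof. by rewrite /r; case: asboolP. Qed.

Let r_sigma : semi_sigma_additive r.
Proof.
move=> F mF tF mUF; rewrite rE//.
rewrite [X in X @ _ --> _](_ : _ = (fun n => \sum_(0 <= i < n) m (F i))).
  exact: m_sigma.
by apply/funext => n; apply: eq_bigr => i _; rewrite rE//; exact: mF.
Qed.

HB.instance Definition _ := isMeasure.Build _ (borel_type T) R r r0 r_ge0 r_sigma.

Let rT : r setT = 1. Proof. by rewrite rE //; exact: measurableT. Qed.

HB.instance Definition _ := Measure_isProbability.Build _ (borel_type T) R r rT.

Lemma borel_prob_of : exists mu : borel_prob T, forall X, borel_set X -> mu X = m X.
Proof.
have off X : ~ borel_set X -> r X = 0 by rewrite /r; case: asboolP.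
by exists (BorelProb off).
Qed.

End borel_prob_of.

Section mass.
Variables (R : realType) (T : pmetricType R).
Implicit Types (mu nu : borel_prob T) (X Y : set T).

Definition mass mu X : R := fine (mu X).

Lemma massE mu X : borel_set X -> (mu X = (mass mu X)%:E)%E.
Proof. by move=> bX; rewrite /mass fineK// fin_num_measure. Qed.

Lemma mass_ext mu nu : (forall X, borel_set X -> mass mu X = mass nu X) -> mu = nu.
Proof. by move=> e; apply: borel_prob_eq => X bX; rewrite !massE// e. Qed.

Lemma mass_ge0 mu X : 0 <= mass mu X.
Proof. exact/fine_ge0/measure_ge0. Qed.

Lemma mass0 mu : mass mu set0 = 0.
Proof. by rewrite /mass measure0. Qed.

Lemma massT mu : mass mu setT = 1.
Proof. by rewrite /mass probability_setT. Qed.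

Lemma le_mass mu X Y : borel_set X -> borel_set Y -> X `<=` Y -> mass mu X <= mass mu Y.
Proof. by move=> bX bY XY; rewrite -lee_fin -!massE// le_measure ?inE. Qed.

Lemma mass_le1 mu X : borel_set X -> mass mu X <= 1.
Proof. by move=> bX; rewrite -(massT mu) le_mass//; exact: measurableT. Qed.

Lemma massU mu X Y : borel_set X -> borel_set Y -> X `&` Y = set0 ->
  mass mu (X `|` Y) = mass mu X + mass mu Y.
Proof.
move=> bX bY XY; apply: EFin_inj; rewrite EFinD -!massE//; last exact: measurableU.
by rewrite measureU.
Qed.

Lemma massU_le mu X Y : borel_set X -> borel_set Y ->
  mass mu (X `|` Y) <= mass mu X + mass mu Y.
Proof.
move=> bX bY; rewrite -lee_fin EFinD -!massE//; last exact: measurableU.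
exact: measureU2.
Qed.

Lemma massD mu X Y : borel_set X -> borel_set Y -> X `<=` Y ->
  mass mu (Y `\` X) = mass mu Y - mass mu X.
Proof.
move=> bX bY XY; apply/eqP; rewrite eq_sym subr_eq -massU//.
- by rewrite setUC setDUK.
- exact: measurableD.
- by rewrite setIC setDIK.
Qed.

Lemma mass_eq mu X Y Z : borel_set X -> borel_set Y -> borel_set Z ->
  mass mu Z = 0 -> X `\` Z = Y `\` Z -> mass mu X = mass mu Y.
Proof.
move=> + + bZ muZ; wlog suff le : X Y / borel_set X -> borel_set Y ->
    X `\` Z = Y `\` Z -> mass mu X <= mass mu Y.
  by move=> bX bY XY; apply/eqP; rewrite eq_le !le.
move=> bX bY XY; rewrite -[leRHS]addr0 -muZ (le_trans _ (massU_le mu bY bZ))//.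
apply: le_mass => //; first exact: measurableU.
move=> x Xx; have [Zx|nZx] := pselect (Z x); [by right|left].
by have : (X `\` Z) x by []; rewrite XY => -[].
Qed.

Lemma cvx_subproof s mu nu : 0 <= s <= 1 -> exists la : borel_prob T,
  forall X, borel_set X -> mass la X = (1 - s) * mass mu X + s * mass nu X.
Proof.
move=> /andP[s0 s1]; have t0 : 0 <= 1 - s by rewrite subr_ge0.
pose m := measure_add (mscale (NngNum t0) mu) (mscale (NngNum s0) nu).
have mE X : borel_set X -> m X = ((1 - s) * mass mu X + s * mass nu X)%:E.
  by move=> bX; rewrite /m measure_addE EFinD !EFinM -!massE.
have [||||] := @borel_prob_of R T m.
- exact: measure0.
- by move=> X; exact: measure_ge0.
- exact: measure_semi_sigma_additive.
- by rewrite mE ?massT; [congr EFin; lra|exact: measurableT].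
by move=> la laE; exists la => X bX; rewrite {1}/mass laE// mE.
Qed.

(** The mixture (1 - s) mu + s nu; the default mu outside [0, 1] makes it total. *)
Definition cvx s mu nu : borel_prob T :=
  if pselect (0 <= s <= 1) is left s01 then sval (cid (cvx_subproof mu nu s01)) else mu.

Lemma mass_cvx s mu nu X : 0 <= s <= 1 -> borel_set X ->
  mass (cvx s mu nu) X = (1 - s) * mass mu X + s * mass nu X.
Proof.
by move=> s01 bX; rewrite /cvx; case: pselect => // ?; case: cid => la /= ->.
Qed.

Lemma dirac_subproof (x : T) : exists la : borel_prob T,
  forall X, borel_set X -> mass la X = \1_X x.
Proof.
have [||||] := @borel_prob_of R T (@dirac _ (borel_type T) x R).
- exact: measure0.
- by move=> X; exact: measure_ge0.
- exact: measure_semi_sigma_additive.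
- exact: probability_setT.
by move=> la laE; exists la => X bX; rewrite /mass laE//.
Qed.

Definition borel_dirac x : borel_prob T := sval (cid (dirac_subproof x)).

Lemma mass_dirac x X : borel_set X -> mass (borel_dirac x) X = \1_X x.
Proof. by rewrite /borel_dirac; case: cid => la /= H /H. Qed.

Lemma mass_induced (f : T -> T) (cf : continuous f) mu X : borel_set X ->
  mass (Defs.induced cf mu) X = mass mu (f @^-1` X).
Proof. by move=> bX; rewrite /mass Defs.inducedE. Qed.

Lemma induced_cvx (f : T -> T) (cf : continuous f) s mu nu : 0 <= s <= 1 ->
  Defs.induced cf (cvx s mu nu) = cvx s (Defs.induced cf mu) (Defs.induced cf nu).
Proof.
move=> s01; apply: mass_ext => X bX; have bfX := borel_preimage cf bX.
by rewrite mass_cvx// !mass_induced// mass_cvx.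
Qed.

Lemma iter_induced_cvx (f : T -> T) (cf : continuous f) n s mu nu : 0 <= s <= 1 ->
  iter n (Defs.induced cf) (cvx s mu nu) =
  cvx s (iter n (Defs.induced cf) mu) (iter n (Defs.induced cf) nu).
Proof. by move=> s01; elim: n => //= n ->; rewrite induced_cvx. Qed.

Lemma borel_iter_preimage (f : T -> T) (cf : continuous f) n X :
  borel_set X -> borel_set (iter n f @^-1` X).
Proof.
move=> bX; elim: n => [|n IHn] //.
rewrite (_ : iter n.+1 f @^-1` X = f @^-1` (iter n f @^-1` X)); first exact: borel_preimage.
by apply/funext => x; rewrite /preimage /= -iterSr.
Qed.

Lemma mass_iter_induced (f : T -> T) (cf : continuous f) n mu X : borel_set X ->
  mass (iter n (Defs.induced cf) mu) X = mass mu (iter n f @^-1` X).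
Proof.
move=> bX; elim: n mu => [|n IHn] mu //.
rewrite iterSr IHn mass_induced; last exact: borel_iter_preimage.
by congr mass; apply/funext => x; rewrite /preimage /= -iterSr.
Qed.

(** A set lies in its enlargement, so the total variation distance dominates the Prohorov
    distance. *)
Lemma mdist_borel_prob_le d mu nu : 0 < d ->
  (forall X, borel_set X -> `|mass mu X - mass nu X| <= d) -> mdist mu nu <= d.
Proof.
move=> d0 H; apply: prohorov_set_ge; split => // X bX.
have bY : borel_set (enlarge X d) := borel_enlarge X d.
have XY : X `<=` enlarge X d.
  by move=> x Xx; apply/enlargeP; exists x => //; rewrite mdistxx.
have := le_mass mu bX bY XY; have := le_mass nu bX bY XY.
have := H _ bX; rewrite ler_norml => /andP[h1 h2] h3 h4.
by rewrite !massE// !lee_fin; split; lra.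
Qed.

End mass.

(** * The Prohorov topology tested on clopen sets *)

Section cantor_mass.
Variable R : realType.
Local Notation X := (cantor_space : pmetricType R).
Implicit Types mu nu : borel_prob X.

Lemma finitary_borel n (A : set cantor_space) : finitary n A -> @borel_set R X A.
Proof. by move=> /(finitary_open R)/(@borel_open R X). Qed.

(** The saturation B of a Borel set under agreement on n+1 coordinates is finitary and lies between
    the set and its d-enlargement. *)
Lemma mdist_le_finitary n d mu nu : n.+1%:R^-1 <= d ->
  (forall A, finitary n.+1 A -> `|mass mu A - mass nu A| <= d) -> mdist mu nu <= d.
Proof.
move=> nd H.
have d0 : 0 < d by apply: lt_le_trans nd; rewrite invr_gt0.
apply: prohorov_set_ge; split => // A bA.
pose B : set cantor_space := [set x | exists2 y, A y & agree n.+1 x y].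
have fB : finitary n.+1 B.
  move=> x y xy; apply/propext; split=> -[z Az xz]; exists z => //.
    by apply: agree_trans xz; exact: agree_sym.
  exact: agree_trans xz.
have bB := finitary_borel fB.
have bY : borel_set (enlarge (A : set X) d) := borel_enlarge _ d.
have AB : A `<=` B by move=> x Ax; exists x.
have BY : B `<=` enlarge (A : set X) d.
  move=> x [y Ay xy]; apply/enlargeP; exists y => //.
  by apply: lt_le_trans nd; apply/mdist_agree.
have := le_mass mu bB bY BY; have := le_mass nu bB bY BY.
have := le_mass mu bA bB AB; have := le_mass nu bA bB AB.
have := H _ fB; rewrite ler_norml => /andP[h1 h2] h3 h4 h5 h6.
by rewrite !massE// !lee_fin; split; lra.
Qed.

Lemma nbhs_massP mu U : nbhs mu U -> exists n e, 0 < e /\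
  forall nu, (forall A, finitary n A -> `|mass nu A - mass mu A| <= e) -> U nu.
Proof.
move=> /(@nbhs_ballP R)[e /= e0 eU].
have [n ne] := @invS_lt R _ (divr_gt0 e0 (@ltr0Sn R 1)).
exists n.+1, (e / 2); rewrite divr_gt0//; split => // nu H; apply: eU.
rewrite ballEmdist/= metric_sym (@le_lt_trans _ _ (e / 2))//; last by lra.
by apply: mdist_le_finitary H; exact: ltW.
Qed.

(** For d at most 1/(n+1), enlarging a set that depends on n coordinates adds no point, so the
    Prohorov inequalities compare the masses of A directly. *)
Lemma nbhs_mass n A mu e : finitary n A -> 0 < e ->
  nbhs mu [set nu | `|mass nu A - mass mu A| < e].
Proof.
move=> fA e0; apply/(@nbhs_ballP R).
pose d := Num.min (e / 2) n.+1%:R^-1.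
have d0 : 0 < d by rewrite lt_min invr_gt0 ltr0Sn andbT; lra.
exists d => // nu; rewrite ballEmdist/= => /prohorov_set_gt[_ H].
have dA (B : set cantor_space) : finitary n B -> enlarge (B : set X) d `<=` B.
  move=> fB x /enlargeP[y By xy].
  rewrite (fB x y)//; apply: agree_le (leqnSn n) _.
  by apply/(mdist_agree R); apply: lt_le_trans xy _; rewrite ge_min lexx orbT.
have bY (B : set X) : borel_set (enlarge B d) by exact: borel_enlarge.
have bA := finitary_borel fA.
have := le_mass mu (bY A) bA (dA _ fA); have := le_mass nu (bY A) bA (dA _ fA).
have := H _ bA; rewrite !massE// -!EFinD !lee_fin => -[h1 h2] h3 h4.
have de : d <= e / 2 by rewrite ge_min lexx.
by rewrite ltr_norml; apply/andP; split; lra.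
Qed.

Lemma mass_ext_finitary mu nu :
  (forall n A, finitary n A -> mass mu A = mass nu A) -> mu = nu.
Proof.
move=> H; apply: (@mdist_positivity R); apply/eqP; rewrite eq_le mdist_ge0 andbT.
apply/ler_addgt0Pl => e /(@invS_lt R)[n ne]; rewrite addr0.
apply: (@mdist_le_finitary n); first exact: ltW.
move=> A fA; rewrite (H _ _ fA) subrr normr0.
by apply: le_trans (ltW ne); rewrite invr_ge0.
Qed.

End cantor_mass.

(** * Measures from finitely additive functions on clopen sets *)

Definition finitary_type := cantor_space.
HB.instance Definition _ := Pointed.on finitary_type.

Definition finitary_display : measure_display.
Proof. exact: default_measure_display. Qed.

Section finitary_algebra.

Definition finitary_sets : set (set finitary_type) :=
  [set A | exists n, finitary n A].

Lemma finitary_sets0 : finitary_sets set0. Proof. by exists 0%N. Qed.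

Lemma finitary_setsU : setU_closed finitary_sets.
Proof.
move=> A B [n fA] [m fB]; exists (maxn n m) => x y xy.
rewrite /setU /=; congr (_ \/ _).
  by apply: fA; apply: agree_le xy; exact: leq_maxl.
by apply: fB; apply: agree_le xy; exact: leq_maxr.
Qed.

Lemma finitary_setsC : setC_closed finitary_sets.
Proof. by move=> A [n fA]; exists n => x y /fA e; rewrite /setC /= e. Qed.

HB.instance Definition _ := isAlgebraOfSets.Build finitary_display finitary_type
  finitary_sets0 finitary_setsU finitary_setsC.

End finitary_algebra.

Section extension.
Variables (R : realType) (m : set cantor_space -> R).
Hypotheses (m_ge0 : forall n A, finitary n A -> 0 <= m A) (mT : m setT = 1)
  (mU : forall n A B, finitary n A -> finitary n B -> A `&` B = set0 ->
    m (A `|` B) = m A + m B).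
Local Open Scope ereal_scope.

Let mu (A : set finitary_type) : \bar R :=
  if `[< finitary_sets A >] then (m A)%:E else 0.

Let muE A : finitary_sets A -> mu A = (m A)%:E.
Proof. by rewrite /mu => fA; case: asboolP. Qed.

Let m0 : m set0 = 0%R.
Proof.
have f0 : finitary 0 (set0 : set cantor_space) by [].
by have := mU f0 f0; rewrite setU0 setI0 => /(_ erefl); lra.
Qed.

Let mu0 : mu set0 = 0.
Proof. by rewrite muE ?m0//; exact: finitary_sets0. Qed.

Let mu_ge0 A : 0 <= mu A.
Proof.
by rewrite /mu; case: asboolP => // -[n fA]; rewrite lee_fin; exact: m_ge0 fA.
Qed.

Let muU A B : finitary_sets A -> finitary_sets B -> A `&` B = set0 ->
  mu (A `|` B) = mu A + mu B.
Proof.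
move=> fA fB AB; rewrite !muE//; last exact: finitary_setsU.
case: fA fB => n fA [k fB].
rewrite (mU (finitary_le (leq_maxl n k) fA) (finitary_le (leq_maxr n k) fB) AB).
exact: EFinD.
Qed.

(* By compactness a countable disjoint union of clopen sets can only be clopen
   when all but finitely many of them are empty. *)
Let mu_sigma : semi_sigma_additive mu.
Proof.
move=> F mF tF [k fU].
have [||N HN] := @uniform_agree R
  (fun n x => (\bigcup_i F i) x -> exists2 i, (i < n)%N & F i x).
- by move=> a b x ab H /H[i ia Fx]; exists i => //; exact: leq_trans ab.
- move=> x; have [[i _ Fx]|nx] := pselect ((\bigcup_i F i) x).
    have [j fj] := mF i; exists (maxn j i.+1) => y xy _; exists i.
      exact: leq_maxr.
    by rewrite -(fj x)//; apply: agree_le xy; exact: leq_maxl.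
  by exists k => y /fU e; rewrite -e.
have sumE n : \sum_(0 <= i < n) mu (F i) = mu (\bigcup_(i < n) F i) /\
    finitary_sets (\bigcup_(i < n) F i).
  elim: n => [|n [IHn fn]].
    by rewrite big_geq// bigcup_mkord big_ord0 mu0; split => //; exact: finitary_sets0.
  rewrite big_nat_recr//= IHn !bigcup_mkord big_ord_recr/= -bigcup_mkord; split.
    rewrite muU//; first exact: mF.
    apply/seteqP; split => // x [[i /= ilt Fi] Fn].
    have /trivIsetP/(_ i n I I) := tF.
    rewrite neq_ltn ilt => /(_ isT) e.
    by have : (F i `&` F n) x by []; rewrite e.
  by apply: finitary_setsU => //; exact: mF.
have cst n : (N <= n)%N -> \bigcup_(i < n) F i = \bigcup_i F i.
  move=> Nn; apply/seteqP; split => [x [i _ Fx]|x /HN[i iN Fx]]; first by exists i.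
  by exists i => //; exact: leq_trans Nn.
apply: cvg_near_cst; exists N => // n /= Nn.
by rewrite (sumE n).1 cst.
Qed.

HB.instance Definition _ := isMeasure.Build _ finitary_type R mu mu0 mu_ge0 mu_sigma.

(** Caratheodory extension from the algebra of clopen sets. Every open set is a countable union of
    finitary ones, so the extension reaches all Borel sets. *)
Lemma finitary_extension : exists nu : borel_prob (cantor_space : pmetricType R),
  forall n A, finitary n A -> mass nu A = m A.
Proof.
pose I : measurableType _ := g_sigma_algebraType (@measurable _ finitary_type).
pose ext : set I -> \bar R := measure_extension mu.
have borel_meas A : @borel_set R cantor_space A -> measurable (A : set I).
  apply: smallest_sub; first exact: smallest_sigma_algebra.
  move=> U oU.
  pose core n : set cantor_space := [set x | forall y, agree n x y -> U y].
  have -> : U = \bigcup_n core n.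
    apply/seteqP; split => [x Ux|x [n _ H]]; last exact: H.
    have /(nbhs_agreeP R)[n nU] : nbhs x U by exact: open_nbhs_nbhs.
    by exists n.
  apply: (@bigcupT_measurable _ I) => n; apply: sub_sigma_algebra.
  exists n => x y xy; apply/propext; split => H z.
    by move=> yz; apply: H; exact: agree_trans yz.
  by move=> xz; apply: H; apply: agree_trans xz; exact: agree_sym.
have extE n A : finitary n A -> ext A = (m A)%:E.
  move=> fA; have fA' : finitary_sets A by exists n.
  rewrite /ext /measure_extension; apply: etrans (muE fA').
  exact: measurable_mu_extE.
have [||||nu nuE] := @borel_prob_of R cantor_space ext.
- exact: measure0.
- by move=> A; exact: measure_ge0.
- move=> F mF tF mUF; apply: (@measure_semi_sigma_additive _ I R (measure_extension mu)) => //.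
  + by move=> i; apply: borel_meas; exact: mF.
  + exact: borel_meas.
- by rewrite (extE 0%N) ?mT.
by exists nu => n A fA; rewrite /mass nuE ?(extE _ _ fA)//; exact: finitary_borel fA.
Qed.

End extension.

(** * Existence of invariant measures *)

Section krylov_bogolyubov.
Variables (R : realType) (g : cantor_space -> cantor_space) (cg : continuous g).
Local Notation X := (cantor_space : pmetricType R).

(* Krylov-Bogolyubov: the Cesaro averages converge along an ultrafilter on every
   clopen set. *)
Lemma invariant_measure (mu : borel_prob X) : exists nu : borel_prob X,
  @Defs.induced R X g cg nu = nu /\
  forall n A c, finitary n A -> (forall j, mass mu (iter j g @^-1` A) = c) ->
    mass nu A = c.
Proof.
have ug := continuous_ucont R cg.
have fpre n A j : finitary n A -> exists k, finitary k (iter j g @^-1` A).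
  by move=> fA; apply: finitary_comp fA (ucont_iter _ ug).
have bpre n A j : finitary n A -> @borel_set R X (iter j g @^-1` A).
  by move=> /fpre-/(_ j)[k]; exact: finitary_borel.
pose f A j : R := mass mu (iter j g @^-1` A).
pose a A N : R := N.+1%:R^-1 * \sum_(0 <= j < N.+1) f A j.
have f01 n A j : finitary n A -> 0 <= f A j <= 1.
  by move=> fA; rewrite mass_ge0 mass_le1//; exact: bpre fA.
have acst A c : (forall j, f A j = c) -> a A = cst c.
  move=> fc; apply/funext => N; rewrite /a (eq_bigr (fun=> c)) => [|j _]; last exact: fc.
  by rewrite big_const_nat subn0 iter_addr_0 -[c *+ _]mulr_natl mulKf// pnatr_eq0.
have a01 n A N : finitary n A -> 0 <= a A N <= 1.
  move=> fA; rewrite /a mulr_ge0 ?invr_ge0//=; last first.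
    by rewrite sumr_ge0// => j _; case/andP: (f01 _ _ j fA).
  rewrite mulrC ler_pdivrMr ?ltr0Sn// mul1r.
  rewrite [leRHS](_ : _ = \sum_(0 <= j < N.+1) 1); last first.
    by rewrite big_const_nat subn0 iter_addr_0.
  by apply: ler_sum => j _; case/andP: (f01 _ _ j fA).
have aU n A B N : finitary n A -> finitary n B -> A `&` B = set0 ->
    a (A `|` B) N = a A N + a B N.
  move=> fA fB AB; rewrite /a -mulrDr -big_split /=; congr (_ * _).
  apply: eq_bigr => j _; rewrite /f preimage_setU massU//.
  - exact: bpre fA.
  - exact: bpre fB.
  - by rewrite -preimage_setI AB preimage_set0.
(* The difference telescopes to the terms of index N+1 and 0, both in [0, 1]. *)
have ashift n A N : finitary n A -> `|a (g @^-1` A) N - a A N| <= N.+1%:R^-1.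
  move=> fA; rewrite /a -mulrBr normrM ger0_norm ?invr_ge0//.
  rewrite ler_piMr ?invr_ge0// -sumrB.
  rewrite (eq_bigr (fun j => f A j.+1 - f A j)); last by [].
  rewrite telescope_sumr// ler_norml.
  have /andP[? ?] := f01 _ _ N.+1 fA; have /andP[? ?] := f01 _ _ 0%N fA.
  by apply/andP; split; lra.
(* All bounded sequences converge along one ultrafilter finer than [\oo]; it takes the place of a
   diagonal subsequence. *)
have [U [UU ooU]] := @ultraFilterLemma nat \oo _.
have [m mlim] : exists m : set cantor_space -> R, forall A n, finitary n A ->
    0 <= m A /\ a A @ U --> m A.
  suff : forall A, exists p : R, forall n, finitary n A -> 0 <= p /\ a A @ U --> p.
    by move=> /choice[m ?]; exists m.
  move=> A; have [[n fA]|nfA] := pselect (exists n, finitary n A); last first.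
    by exists 0 => n fA; case: nfA; exists n.
  have UA : ProperFilter (a A @ U) by exact: fmap_proper_filter.
  have [|p [p01 clp]] := @segment_compact R 0 1 (a A @ U) _.
    apply: (@filterS _ U _ setT _ _ filterT) => N _; rewrite /= in_itv/=; exact: a01 fA.
  have cvp : a A @ U --> p.
    move=> V pV; have [//|nV] := in_ultra_setVsetC (a A @^-1` V) UU.
    by have [x []] := clp (~` V) V nV pV.
  exists p => k _; split => //.
  by move: p01; rewrite /= in_itv/= => /andP[].
have lim_unique (u : nat -> R) (x y : R) : u @ U --> x -> u @ U --> y -> x = y.
  exact: cvg_unique.
have [||| nu nuE] := @finitary_extension R m.
- by move=> n A /mlim[].
- have fT : finitary 0 (setT : set cantor_space) by [].
  apply: (lim_unique (a setT)); first by have [] := mlim _ _ fT.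
  rewrite (acst _ 1); first exact: cvg_cst.
  by move=> j; rewrite /f preimage_setT massT.
- move=> n A B fA fB AB.
  have fAB : finitary n (A `|` B) by move=> x y xy; rewrite /setU /= (fA _ _ xy) (fB _ _ xy).
  apply: (lim_unique (a (A `|` B))); first by have [] := mlim _ _ fAB.
  rewrite (_ : a (A `|` B) = a A \+ a B); last by apply/funext => N; exact: aU fA fB AB.
  by apply: cvgD; [have [] := mlim _ _ fA|have [] := mlim _ _ fB].
exists nu; split; last first.
  move=> n A c fA fc; rewrite (nuE _ _ fA).
  apply: (lim_unique (a A)); first by have [] := mlim _ _ fA.
  by rewrite (acst _ c)//; exact: cvg_cst.
apply: mass_ext_finitary => n A fA; rewrite mass_induced; last exact: finitary_borel fA.
have [k fgA] := fpre _ _ 1%N fA; rewrite (nuE _ _ fA) (nuE _ _ fgA).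
have [_ limA] := mlim _ _ fA; have [_ limgA] := mlim _ _ fgA.
apply: (lim_unique (a (g @^-1` A))) => //.
have lim0 : (a (g @^-1` A) \- a A) @ U --> (0 : R).
  apply: (cvg_trans (G := (a (g @^-1` A) \- a A) @ \oo)).
    by move=> V /= VV; exact: ooU.
  apply/cvgr0Pnorm_lt => e e0.
  have := near_infty_natSinv_lt (PosNum e0); apply: filterS => N /= Ne.
  exact: le_lt_trans (ashift _ _ _ fA) Ne.
rewrite (_ : a (g @^-1` A) = (a (g @^-1` A) \- a A) \+ a A); last first.
  by apply/funext => N /=; rewrite subrK.
by rewrite -[m A]add0r; exact: cvgD.
Qed.

End krylov_bogolyubov.

(** * Dynamics of the induced map *)

Lemma uncountable_itvoo (R : realType) (a : R) : 0 < a -> ~ countable `]0, a[%classic.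
Proof.
move=> a0 /countable_lebesgue_measure0; rewrite lebesgue_measure_itv/= lte_fin a0.
by rewrite -EFinB subr0 => -[]; lra.
Qed.

(** * Segments of measures *)

Section cvx_theory.
Variables (R : realType) (T : pmetricType R).
Implicit Types mu nu : borel_prob T.

Lemma cvx0 mu nu : cvx 0 mu nu = mu.
Proof.
by apply: mass_ext => X bX; rewrite mass_cvx// ?lexx ?ler01// subr0 mul1r mul0r addr0.
Qed.

Lemma cvx1 mu nu : cvx 1 mu nu = nu.
Proof.
by apply: mass_ext => X bX; rewrite mass_cvx// ?lexx ?ler01// subrr mul0r mul1r add0r.
Qed.

Lemma mass_cvx_dist mu nu s t X : 0 <= s <= 1 -> 0 <= t <= 1 -> borel_set X ->
  `|mass (cvx s mu nu) X - mass (cvx t mu nu) X| <= `|s - t|.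
Proof.
move=> s01 t01 bX; rewrite !mass_cvx//.
rewrite (_ : _ - _ = (s - t) * (mass nu X - mass mu X)); last by lra.
rewrite normrM ler_piMr// ler_norml.
have := mass_ge0 mu X; have := mass_ge0 nu X.
have := mass_le1 mu bX; have := mass_le1 nu bX.
by move=> *; apply/andP; split; lra.
Qed.

Lemma mdist_cvx_le mu nu s t d : 0 <= s <= 1 -> 0 <= t <= 1 -> 0 < d ->
  `|s - t| <= d -> mdist (cvx s mu nu) (cvx t mu nu) <= d.
Proof.
move=> s01 t01 d0 std; apply: mdist_borel_prob_le => // X bX.
by apply: le_trans std; exact: mass_cvx_dist.
Qed.

Lemma cvx_inj mu nu s t : 0 <= s <= 1 -> 0 <= t <= 1 -> mu <> nu ->
  cvx s mu nu = cvx t mu nu -> s = t.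
Proof.
move=> s01 t01 mn e; apply: contrapT => st; apply: mn; apply: mass_ext => X bX.
have := congr1 (fun la => mass la X) e; rewrite !mass_cvx// => eX.
have /eqP : (s - t) * (mass nu X - mass mu X) = 0 by lra.
by rewrite mulf_eq0 !subr_eq0 => /orP[] /eqP.
Qed.

(** The displacement of a mixture under [iter j] is affine in the parameter; vanishing at s and t,
    it vanishes on the whole segment, hence at its end nu. *)
Lemma iter_induced_cvx_fixed (f : T -> T) (cf : continuous f) mu nu j s t :
  0 <= s <= 1 -> 0 <= t <= 1 -> s <> t ->
  iter j (Defs.induced cf) (cvx s mu nu) = cvx s mu nu ->
  iter j (Defs.induced cf) (cvx t mu nu) = cvx t mu nu ->
  iter j (Defs.induced cf) nu = nu.
Proof.
move=> s01 t01 st; rewrite !iter_induced_cvx// => es et; apply: mass_ext => X bX.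
have := congr1 (fun la => mass la X) es; have := congr1 (fun la => mass la X) et.
rewrite !mass_cvx//.
set a := mass (iter j _ mu) X; set b := mass (iter j _ nu) X.
move: (mass mu X) (mass nu X) => a' b' e1 e2.
have /eqP : (s - t) * ((b - b') - (a - a')) = 0 by lra.
rewrite mulf_eq0 !subr_eq0 => /orP[] /eqP // e3; have : a = a' + (b - b') by lra.
by move=> e4; move: e1; rewrite e4; lra.
Qed.

End cvx_theory.

(** * Periodic and chain recurrent measures *)

Section periodic_points.
Variables (R : realType) (T : pmetricType R) (f : T -> T) (cf : continuous f).
Local Notation ft := (@Defs.induced R T f cf).

Lemma iterMp (p : nat) (mu : borel_prob T) : iter p ft mu = mu ->
  forall k, iter (k * p) ft mu = mu.
Proof. by move=> e; elim=> // k IHk; rewrite mulSn iterD IHk. Qed.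

(** All mixtures of mu and eta are fixed by [iter (k * p)], and only countably many of them have a
    smaller period, because eta has not. The other short ones are distinct points of U, and there
    are uncountably many. *)
Lemma uncountable_periodic_cvx p k mu eta e (U : set (borel_prob T)) :
  (0 < k)%N -> periodic_pts ft p mu -> periodic_pts ft (k * p) eta -> mu <> eta ->
  0 < e -> (forall s, 0 < s < e -> s < 1 -> U (cvx s mu eta)) ->
  ~ countable (U `&` periodic_pts ft (k * p)).
Proof.
move=> k0 [p0 fmu _] [kp0 feta eta_min] mu_eta e0 HU cQ.
pose e' := Num.min e 1; have e'0 : 0 < e' by rewrite lt_min e0 ltr01.
have itv s : `]0, e'[%classic s -> [/\ 0 < s < e, s < 1 & 0 <= s <= 1].
  rewrite /= in_itv/= lt_min => /andP[s0 /andP[se s1]].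
  by rewrite s0 se s1 !ltW.
apply: (@uncountable_itvoo R e') => //.
pose good := [set s | `]0, e'[%classic s /\ (U `&` periodic_pts ft (k * p)) (cvx s mu eta)].
(* Along the segment from mu to eta at most one point has iter j fixed, unless
   iter j fixes eta. *)
pose bad j := [set s | `]0, e'[%classic s /\ (0 < j < k * p)%N /\
  iter j ft (cvx s mu eta) = cvx s mu eta].
apply: (@sub_countable _ _ _ (good `|` \bigcup_j bad j)).
  apply: subset_card_le => s se; have [s0e s1 s01] := itv _ se.
  have [[j Hj]|nj] := pselect (exists j, bad j s); first by right; exists j.
  left; split => //; split; first exact: HU.
  split => //; first by rewrite iter_induced_cvx// feta iterMp.
  by move=> j j0 fj; apply: nj; exists j.
rewrite -bigcup2E; apply: bigcup_countable => // -[|[|i]] _ //=.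
- apply: (@sub_countable _ _ _ (U `&` periodic_pts ft (k * p))) => //.
  rewrite -(card_le_eql (@inj_card_eq _ _ good (fun s => cvx s mu eta) _)).
    by apply: subset_card_le => _ [s [_ ?] <-].
  move=> s t /set_mem[/itv[_ _ s01] _] /set_mem[/itv[_ _ t01] _].
  exact: cvx_inj.
- apply: bigcup_countable => // j _.
  have [[s Hs]|nb] := pselect (exists s, bad j s); last first.
    rewrite (_ : bad j = set0); first exact: countable0.
    by apply/seteqP; split => // s Hs; apply: nb; exists s.
  apply: (@sub_countable _ _ _ [set s]); last exact: countable1.
  apply: subset_card_le => t [/itv[_ _ t01] [jp ft_t]].
  move: Hs => [/itv[_ _ s01] [_ ft_s]].
  apply: contrapT => ts; apply: (eta_min _ jp).
  exact: iter_induced_cvx_fixed t01 s01 ts ft_t ft_s.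
Qed.

Lemma periodic_of_iter q (mu : borel_prob T) : (0 < q)%N -> iter q ft mu = mu ->
  all_periodic_pts ft mu.
Proof.
move=> q0 fq.
have ex : exists n, (0 < n)%N && `[< iter n ft mu = mu >].
  by exists q; rewrite q0; apply/asboolP.
case: (ex_minnP ex) => p /andP[p0 /asboolP fp] pmin.
exists p => //; split => // j /andP[j0 jp] fj.
by have := pmin j; rewrite j0 leqNgt jp => /(_ (asboolT fj)).
Qed.

Lemma periodic_nonwandering : all_periodic_pts ft `<=` nonwandering_pts ft.
Proof.
move=> mu [p _ [p0 fp _]] U Umu; exists p => //; exists mu; split.
  by exists mu => //; exact: nbhs_singleton.
exact: nbhs_singleton.
Qed.

Lemma recurrent_nonwandering : recurrent_pts ft `<=` nonwandering_pts ft.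
Proof.
move=> mu Rmu U Umu; have [n n0 Un] := Rmu U Umu; exists n => //.
by exists (iter n ft mu); split => //; exists mu => //; exact: nbhs_singleton.
Qed.

(* A pseudo-orbit from mu to mu: mix the forward orbit of mu more and more with
   the fixed measure nu, then come back along the backward orbit of mu. *)
Lemma chain_recurrent_induced g (cg : continuous g) nu : cancel g f -> ft nu = nu ->
  chain_recurrent_pts ft = setT.
Proof.
move=> gK fnu; apply/seteqP; split => // mu _ d /(@invS_lt R)[n nd].
pose gt := @Defs.induced R T g cg.
have gtK : cancel gt ft.
  move=> la; apply: mass_ext => X bX; rewrite !mass_induced//; last exact: borel_preimage.
  by congr mass; apply/funext => x; rewrite /preimage /= gK.
pose M := n.+1.
pose s j : R := if (j <= M)%N then j%:R / M%:R else (M + M - j)%:R / M%:R.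
pose a j := if (j <= M)%N then iter j ft mu else iter (M + M - j) gt mu.
have M0 : (0 : R) < M%:R by rewrite ltr0n.
have ratio (i : nat) : (i <= M)%N -> 0 <= (i%:R / M%:R : R) <= 1.
  move=> iM; apply/andP; split; first exact: divr_ge0.
  by rewrite ler_pdivrMr// mul1r ler_nat.
have s01 j : (j <= M + M)%N -> 0 <= s j <= 1.
  by move=> jM; rewrite /s; case: leqP => ?; apply: ratio => //; lia.
have sM : s M = 1 by rewrite /s leqnn divff// gt_eqF.
have sstep j : (j < M + M)%N -> `|s j - s j.+1| <= M%:R^-1.
  move=> jM; rewrite /s; case: (ltngtP j M) => [jlt|jgt|->].
  - by rewrite -mulrBl -natr1 opprD addNKr normrM normrN1 mul1r ger0_norm// invr_ge0.
  - rewrite -mulrBl -natrB; last lia.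
    rewrite (_ : (M + M - j - (M + M - j.+1))%N = 1%N); last lia.
    by rewrite mul1r ger0_norm// invr_ge0.
  - rewrite (_ : (M + M - M.+1)%N = n); last by rewrite /M; lia.
    by rewrite -mulrBl -natr1 addrC addKr mul1r ger0_norm// invr_ge0.
exists (M + M)%N; first by rewrite /M.
exists (fun j => cvx (s j) (a j) nu); split.
- by rewrite /s /a /= mul0r cvx0.
- have MM : (M + M <= M)%N = false by apply/negbTE; rewrite /M; lia.
  by rewrite /s /a MM subnn mul0r cvx0.
- move=> j jM; apply: le_lt_trans nd.
  have Mi : (0 : R) < M%:R^-1 by rewrite invr_gt0.
  have sj := s01 _ (ltnW jM); have sj1 := s01 _ jM.
  rewrite induced_cvx// fnu.
  (* At time M the mixture is nu itself, so the switch from the forward to the backward orbit costs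
     nothing. At other times a j is mapped to a (j+1) and only the weight changes, by at most
     1/M. *)
  have [->|jneq] := eqVneq j M.
    rewrite sM cvx1 -{1}(cvx1 (a M.+1) nu).
    have := sstep M; rewrite sM => stepM.
    apply: mdist_cvx_le => //; first by rewrite ler01 lexx.
      by apply: s01; rewrite /M; lia.
    by apply: stepM; rewrite /M; lia.
  have -> : Defs.induced cf (a j) = a j.+1.
    rewrite /a; case: (ltngtP j M) jneq => // jlt _.
    rewrite (_ : (M + M - j)%N = (M + M - j.+1).+1); last lia.
    exact: gtK.
  by apply: mdist_cvx_le => //; exact: sstep.
Qed.

End periodic_points.

(** * Consequences of gradedness at one scale *)

Section graded_dynamics.
Variables (R : realType) (f : cantor_space -> cantor_space) (cf : continuous f).
Local Notation X := (cantor_space : pmetricType R).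
Local Notation ft := (@Defs.induced R X f cf).

Let uf : ucont f := continuous_ucont R cf.

Let finitary_iter n A j : finitary n A -> exists m, finitary m (iter j f @^-1` A).
Proof. by move=> fA; apply: finitary_comp fA (ucont_iter _ uf). Qed.

Let borel_iter n A j : finitary n A -> @borel_set R X (iter j f @^-1` A).
Proof. by move=> /finitary_iter-/(_ j)[m]; exact: finitary_borel. Qed.

Lemma iter_invariant p (mu : borel_prob X) : (0 < p)%N ->
  exists nu : borel_prob X, iter p ft nu = nu /\
  forall n A c, finitary n A ->
    (forall j, mass mu (iter (j * p) f @^-1` A) = c) -> mass nu A = c.
Proof.
move=> p0.
have cfp : continuous (iter p f) by apply: (ucont_continuous R); exact: ucont_iter.
have [nu [gnu nuE]] := @invariant_measure R _ cfp mu.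
exists nu; split.
  apply: mass_ext => A bA; rewrite -[in RHS]gnu mass_iter_induced//.
  by rewrite mass_induced.
move=> n A c fA H; apply: nuE fA _ => j; rewrite -(H j); congr mass.
suff -> : iter j (iter p f) = iter (j * p) f by [].
apply/funext => x; elim: j => // j IHj.
by rewrite mulSn iterD -IHj.
Qed.

(** Average a Dirac mass at x along f^d. The phase class of x modulo d keeps mass 1, while its j-th
    preimage has mass 0 for 0 < j < d, so the period is exactly d. Starting points with different
    [c] give different measures. *)
Lemma graded_periodic n d : (0 < d)%N -> graded n d f ->
  exists eta1 eta2, [/\ periodic_pts ft d eta1, periodic_pts ft d eta2 & eta1 <> eta2].
Proof.
move=> d0 [m [q [K [J [I [c [[q0 dq _ fI fc] [_ _ Ih ch] _ _ [x1 [x2 c12]]]]]]]]].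
have I_iter j x : I (iter j f x) = I x + j %[mod d].
  elim: j => [|j IHj]; first by rewrite addn0.
  rewrite iterS -(modn_dvdm _ dq) Ih modn_dvdm// -addn1 -modnDml IHj modnDml.
  by rewrite addn1 addnS.
have c_iter j x : c (iter j f x) = c x by elim: j => //= j; rewrite ch.
have eta x : exists eta, periodic_pts ft d eta /\
    forall y, mass eta [set z | c z = c y] = (c x == c y)%:R.
  have [eta [feta etaE]] := iter_invariant (borel_dirac (x : X)) d0.
  exists eta; split; last first.
    move=> y; have fC : finitary m [set z | c z = c y] by move=> u v /fc /= ->.
    apply: (etaE _ _ _ fC) => j; rewrite mass_dirac; last exact: borel_iter fC.
    rewrite indicE; congr (nat_of_bool _)%:R.
    by apply/idP/eqP; rewrite in_setE /preimage /= c_iter.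
  pose A i := [set z | I z = I x + i %[mod d]].
  have fA i : finitary m (A i) by move=> u v /fI uv; rewrite /A /= uv.
  split => // j /andP[j0 jd] fj.
  have : mass (iter j ft eta) (A 0%N) = mass eta (A 0%N) by rewrite fj.
  rewrite mass_iter_induced; last exact: finitary_borel (fA 0%N).
  have -> : mass eta (A 0%N) = 1.
    apply: (etaE _ _ _ (fA 0%N)) => i; rewrite mass_dirac; last exact: borel_iter (fA 0%N).
    by rewrite indicE mem_set//= /A /= I_iter -modnDmr modnMl addn0.
  have [k fk] := finitary_iter j (fA 0%N).
  rewrite (etaE _ _ 0 fk) => [|i]; first by move/eqP; rewrite eq_sym oner_eq0.
  rewrite mass_dirac; last exact: borel_iter fk.
  rewrite indicE memNset//= /A /= addn0 -iterD I_iter => /eqP.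
  rewrite -{2}[I x]addn0 eqn_modDl mod0n -modnDmr modnMl addn0 modn_small//.
  by rewrite gtn_eqF.
have [eta1 [p1 e1]] := eta x1; have [eta2 [p2 e2]] := eta x2.
exists eta1, eta2; split => // e12.
have := e2 x1; rewrite -e12 e1 eqxx; case: eqP => [e|_]; first by rewrite e in c12.
by move/eqP; rewrite oner_eq0.
Qed.

(** The mass of A never decreases along orbits. If mu gained mass in one step, all measures near mu
    would gain almost as much, keep it, and never return near mu. The same argument applies to each
    preimage of A. *)
Lemma mass_iter_nonwandering n A mu : finitary n A -> A `<=` f @^-1` A ->
  nonwandering_pts ft mu -> forall j, mass mu (iter j f @^-1` A) = mass mu A.
Proof.
move=> fA Af muO.
have step k B : finitary k B -> B `<=` f @^-1` B -> mass mu (f @^-1` B) = mass mu B.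
  move=> fB Bf; have bB := @finitary_borel R _ _ fB.
  have [l fB1] := finitary_iter 1 fB; have bB1 := @finitary_borel R _ _ fB1.
  apply/eqP; rewrite eq_le (le_mass mu bB bB1 Bf) andbT; apply/ler_addgt0Pl => e e0.
  have e2 : 0 < e / 2 by lra.
  have [i i0 [nu' [[nu [nuB nuB1]] + [nu'B _]]]] :=
    muO _ (filterI (nbhs_mass mu fB e2) (nbhs_mass mu fB1 e2)).
  move=> nu'E; move: nu'B; rewrite -nu'E /= mass_iter_induced//.
  have B1i : f @^-1` B `<=` iter i f @^-1` B.
    case: i i0 {nu'E} => // i _ x Bfx; elim: i => // i; exact: Bf.
  have := le_mass nu bB1 (borel_iter i fB) B1i.
  move: nuB1; rewrite /= !ltr_norml => /andP[? ?] ? /andP[? ?]; lra.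
elim=> // j IHj; rewrite -IHj.
have [k fk] := finitary_iter j fA.
rewrite -(step _ _ fk); first by congr mass; apply/funext => x; rewrite /preimage /= -iterSr.
by move=> x; rewrite /preimage /= -iterSr; exact: Af.
Qed.

(** After a multiple of q steps [I] modulo q and [c] have their initial values, and almost surely
    [J] too; hence the first n coordinates are almost surely the same as before. *)
Lemma graded_nonwandering n d mu : graded n d f -> nonwandering_pts ft mu ->
  exists2 q, (0 < q)%N & forall j A, finitary n A ->
    mass mu (iter (j * q) f @^-1` A) = mass mu A.
Proof.
move=> [m [q [K [J [I [c [[q0 dq fJ fI fc] [JK Jf If cf'] JIc _ _]]]]]]] muO.
have I_iter i x : I (iter i f x) = I x + i %[mod q].
  elim: i => [|i IHi]; first by rewrite addn0.
  by rewrite iterS If -addn1 -modnDml IHi modnDml addn1 addnS.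
have c_iter i x : c (iter i f x) = c x by elim: i => //= i; rewrite cf'.
have J_iter i x : (J x <= J (iter i f x))%N.
  by elim: i => // i; move/leq_trans; apply; exact: Jf.
exists q => // j A fA; set i := (j * q)%N.
(* The superlevel sets of J keep their mass, so J is almost surely constant along
   orbits. *)
pose B t := [set x | (t <= J x)%N].
have fB t : finitary m (B t) by move=> x y /fJ xy; rewrite /B /= xy.
have Bf t : B t `<=` f @^-1` B t by move=> x /leq_trans; apply; exact: Jf.
have bB t := @finitary_borel R _ _ (fB t).
have bBi t := borel_iter i (fB t).
have BBi t : B t `<=` iter i f @^-1` B t.
  by move=> x /leq_trans; apply; exact: J_iter.
(* The points where [J] crosses some threshold t < T within i steps. This is a finite union of null
   sets, and as J <= K, the choice T = K+1 catches every point where [J] has increased. *)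
pose Z T := [set x | exists2 t, (t < T)%N & (iter i f @^-1` B t `\` B t) x].
have ZS T : Z T.+1 = Z T `|` (iter i f @^-1` B T `\` B T).
  apply/seteqP; split => x.
    by move=> [t]; rewrite ltnS leq_eqVlt => /predU1P[->|tT] ?; [right|left; exists t].
  by move=> [[t tT ?]|?]; [exists t => //; exact: ltnW|exists T].
have mZ T : @borel_set R X (Z T) /\ mass mu (Z T) = 0.
  elim: T => [|T [bZ IHT]].
    rewrite (_ : Z 0%N = set0); last by apply/seteqP; split => // x [].
    split; [exact: measurable0|exact: mass0].
  have bD : @borel_set R X (iter i f @^-1` B T `\` B T)
    by exact: (@measurableD _ (@borel_type R X) _ _ (bBi T) (bB T)).
  rewrite ZS; split; first exact: measurableU.
  apply/eqP; rewrite eq_le mass_ge0 andbT (le_trans (massU_le mu bZ bD))//.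
  by rewrite IHT massD// (mass_iter_nonwandering (fB T) (Bf T) muO) subrr addr0.
have [bZ Z0] := mZ K.+1.
apply: mass_eq Z0 _ => //; [exact: borel_iter fA|exact: finitary_borel fA|].
have agZ x : ~ Z K.+1 x -> agree n (iter i f x) x.
  move=> nZ; apply: JIc.
  - apply/eqP; rewrite eqn_leq; apply/andP; split; last first.
      exact: J_iter.
    rewrite leqNgt; apply/negP => lt; apply: nZ.
    exists (J (iter i f x)); first by rewrite ltnS.
    by split; rewrite /B /preimage /= ?leqnn// leqNgt lt.
  - by rewrite I_iter /i -modnDmr modnMl addn0.
  - exact: c_iter.
apply/seteqP; split => x [Ax nZ]; split => //; move: Ax; rewrite /preimage /=.
  by rewrite (fA _ _ (agZ _ nZ)).
by rewrite (fA _ _ (agZ _ nZ)).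
Qed.

End graded_dynamics.

Lemma graded_le n n' d d' h : (n' <= n)%N -> (d' %| d)%N ->
  graded n d h -> graded n' d' h.
Proof.
move=> nn dd [m [q [K [J [I [c [[q0 dq fJ fI fc] H JIc JJ cc]]]]]]].
exists m, q, K, J, I, c; split => //; first by split => //; exact: dvdn_trans dq.
by move=> x y eJ eI ec; apply: agree_le nn _; exact: JIc.
Qed.

(** * Homeomorphisms graded at all scales *)

Section graded_conclusions.
Variables (R : realType) (f g : cantor_space -> cantor_space).
Hypotheses (cf : continuous f) (cg : continuous g) (gK : cancel g f).
Hypothesis gradedf : forall n d, (0 < d)%N -> graded n.+1 d f.
Local Notation X := (cantor_space : pmetricType R).
Local Notation ft := (@Defs.induced R X f cf).

Lemma uncountable_periodic_near p k mu U : (0 < k)%N -> periodic_pts ft p mu ->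
  nbhs mu U -> ~ countable (U `&` periodic_pts ft (k * p)).
Proof.
move=> k0 pmu Umu; have p0 : (0 < p)%N by case: pmu.
have kp0 : (0 < k * p)%N by rewrite muln_gt0 k0.
(* Of two measures of period k p at least one differs from mu; the choice matters for k = 1. *)
have [eta peta mu_eta] : exists2 eta, periodic_pts ft (k * p) eta & mu <> eta.
  have [eta1 [eta2 [p1 p2 e12]]] := graded_periodic R cf kp0 (gradedf 0 kp0).
  have [e1|] := pselect (mu = eta1); last by exists eta1.
  by exists eta2 => //; rewrite e1.
have [n [e [e0 HU]]] := nbhs_massP Umu.
apply: (uncountable_periodic_cvx k0 pmu peta mu_eta e0) => s /andP[s0 se] s1.
apply: HU => A fA; apply: le_trans (ltW se).
rewrite -{2}(cvx0 mu eta).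
apply: le_trans (_ : `|s - 0| <= s); last by rewrite subr0 ger0_norm// ltW.
apply: mass_cvx_dist; rewrite ?lexx ?ler01 ?ltW//; exact: finitary_borel fA.
Qed.

Lemma nonwandering_recurrent : nonwandering_pts ft `<=` recurrent_pts ft.
Proof.
move=> mu muO U /nbhs_massP[n [e [e0 HU]]].
have [q q0 H] := graded_nonwandering (gradedf n (ltn0Sn 0)) muO.
exists q => //; apply: HU => A fA.
rewrite mass_iter_induced; last exact: finitary_borel fA.
by have := H 1%N A (finitary_le (leqnSn n) fA); rewrite mul1n => ->; rewrite subrr normr0 ltW.
Qed.

Lemma periodic_dense_nonwandering : nonwandering_pts ft `<=` closure (all_periodic_pts ft).
Proof.
move=> mu muO U /nbhs_massP[n [e [e0 HU]]].
have [q q0 H] := graded_nonwandering (gradedf n (ltn0Sn 0)) muO.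
have [nu [fnu nuE]] := iter_invariant cf mu q0.
exists nu; split; first exact: periodic_of_iter fnu.
apply: HU => A fA; have fA1 := finitary_le (leqnSn n) fA.
by rewrite (nuE _ _ (mass mu A) fA) ?subrr ?normr0 ?ltW// => j; exact: H.
Qed.

Lemma nonwandering_interior0 : (nonwandering_pts ft)° = set0.
Proof.
apply/seteqP; split => // mu muO.
have [n [e [e0 HU]]] := nbhs_massP muO.
have [m [q [K [J [I [c [[_ _ fJ _ _] [_ Jf _ _] _ [x Jx] _]]]]]]] := gradedf 0 (ltn0Sn 0).
(* A contains f x but not x, so a Dirac mass at x gives the preimage of A more mass than A, which a
   nonwandering measure does not allow. *)
pose A := [set y | (J (f x) <= J y)%N].
have fA : finitary m A by move=> y z /fJ yz; rewrite /A /= yz.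
have Af : A `<=` f @^-1` A by move=> y /leq_trans; apply; exact: Jf.
have bA := @finitary_borel R _ _ fA; have bfA := borel_preimage cf bA.
pose s := Num.min e 1; have s0 : 0 < s by rewrite lt_min e0 ltr01.
have s01 : 0 <= s <= 1 by rewrite ltW//= ge_min lexx orbT.
have /(mass_iter_nonwandering fA Af)/(_ 1%N) :
    nonwandering_pts ft (cvx s mu (borel_dirac (x : X))).
  apply: HU => B fB; apply: le_trans (_ : s <= e); last by rewrite ge_min lexx.
  rewrite -{2}(cvx0 mu (borel_dirac (x : X))).
  apply: le_trans (_ : `|s - 0| <= s); last by rewrite subr0 ger0_norm// ltW.
  by apply: mass_cvx_dist; rewrite ?lexx ?ler01//; exact: finitary_borel fB.
rewrite -/(f @^-1` A) !mass_cvx// !mass_dirac// !indicE.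
rewrite (_ : x \in f @^-1` A = true); last by rewrite mem_set//= /preimage /A /=.
rewrite (_ : x \in A = false); last by rewrite memNset// /A /= leqNgt Jx.
rewrite mulr1 mulr0 addr0; have := le_mass mu bA bfA Af.
move: (mass mu A) (mass mu (f @^-1` A)) s01 s0 => a b /andP[_ s1] s0 ab eab.
have : 0 <= (1 - s) * (b - a) by rewrite mulr_ge0// subr_ge0.
lra.
Qed.

Lemma chain_recurrent_all : chain_recurrent_pts ft = setT.
Proof.
have [nu [fnu _]] := invariant_measure cf (borel_dirac (point : X)).
exact: (@chain_recurrent_induced R X f cf g cg nu).
Qed.

(** An invariant measure has period 1, and p is a multiple of 1. *)
Lemma uncountable_periodic p : (0 < p)%N -> ~ countable (periodic_pts ft p).
Proof.
move=> p0; have [nu [fnu _]] := invariant_measure cf (borel_dirac (point : X)).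
have p1 : periodic_pts ft 1 nu by split => // j; lia.
have := uncountable_periodic_near p0 p1 (filterT : nbhs nu setT).
by rewrite setTI muln1; apply.
Qed.

End graded_conclusions.

(** * Meagerness of the exceptional set *)

Section genericity.
Variable R : realType.

Lemma mdist_homeo_agree n (h h' : cantor_homeo R) :
  (forall x, agree n.+1 (h' x) (h x)) -> mdist h h' <= n.+1%:R^-1.
Proof.
move=> H; apply: homeo_dist_le => x; apply/ltW/mdist_agree/agree_sym; exact: H.
Qed.

Lemma agree_mdist_homeo n (h h' : cantor_homeo R) x :
  mdist h h' < n.+1%:R^-1 -> agree n.+1 (h x) (h' x).
Proof. by move=> H; apply/(mdist_agree R); apply: le_lt_trans H; exact: homeo_dist_ge. Qed.

(** Any ball contains a graded homeomorphism, by density, and with it a whole ball of graded ones,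
    by openness; that ball misses A. *)
Lemma not_graded_nowhere_dense n d (A : set (cantor_homeo R)) : (0 < d)%N ->
  (forall h, A h -> ~ graded n.+1 d h) -> nowhere_dense A.
Proof.
move=> d0 nA; apply/seteqP; split => // h /(@nbhs_ballP R)[e /= /(@invS_lt R)[k ke] eA].
have [hi [hK hiK ch chi]] := homeo_valP h.
(* In the maximum, n serves the scale to be reached and k the distance to h. *)
have [f [g [uf ug fK gK [fh grf]]]] :=
  graded_dense R (maxn n k) d0 (continuous_ucont R ch) hK hiK.
have hf : is_homeo f by exists g; split => //; exact: (ucont_continuous R).
pose h' : cantor_homeo R := CantorHomeo R hf.
have {}grf : graded n.+1 d h'.
  by apply: graded_le grf => //; rewrite ltnS leq_maxl.
have /eA hA : ball h e h'.
  rewrite ballEmdist/=; apply: le_lt_trans ke; apply: mdist_homeo_agree => x.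
  by apply: agree_le (fh x); rewrite ltnS leq_maxr.
have [m Hm] := graded_open grf.
have [|h'' [Ah'']] := hA (ball h' m.+1%:R^-1).
  by apply: nbhsx_ballx; rewrite invr_gt0.
rewrite ballEmdist/= => /agree_mdist_homeo h''m; apply: nA Ah'' _.
by apply: Hm => x; apply: agree_le (h''m x).
Qed.

End genericity.

Theorem theorem17 (R : realType) :
  generic (fun h : cantor_homeo R =>
    let ht := homeo_induced h in
    [/\ forall p : nat, (0 < p)%N -> ~ countable (periodic_pts ht p),
        forall (p : nat) mu, periodic_pts ht p mu ->
          forall U, nbhs mu U -> forall k : nat, (0 < k)%N ->
          ~ countable (U `&` periodic_pts ht (k * p)),
        recurrent_pts ht = nonwandering_pts ht /\
          chain_recurrent_pts ht = setT,
        (nonwandering_pts ht)° = set0 &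
        dense_in (all_periodic_pts ht) (nonwandering_pts ht)]).
Proof.
rewrite /generic; set P := (P in [set x | ~ P x]).
(* The pairs (k+1, (k+1)!) dominate every scale n+1 and divisor d, with k = max n d. Intersecting
   with the failure of [P] makes the union equal to the exceptional set, as [meager] asks. *)
exists (fun k => [set h : cantor_homeo R | ~ P h /\ ~ graded k.+1 (k.+1)`! h]).
  by move=> k; apply: (not_graded_nowhere_dense (n := k) (fact_gt0 k.+1)) => h [].
apply/seteqP; split => [h nPh|h [k _ []]//].
apply: contrapT => nU; apply: (nPh).
have gradedh n d : (0 < d)%N -> graded n.+1 d h.
  move=> d0; apply: contrapT => ng; apply: nU; exists (maxn n d) => //; split => //.
  move=> g; apply: ng; apply: (graded_le _ _ g); first by rewrite ltnS leq_maxl.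
  by apply: dvdn_fact; rewrite d0 /=; apply: leqW; exact: leq_maxr.
have [hi [hK hiK ch chi]] := homeo_valP h.
split.
- exact: uncountable_periodic.
- by move=> p mu pmu U Umu k k0; apply: (uncountable_periodic_near gradedh k0 pmu Umu).
- split; last exact: chain_recurrent_all chi hiK.
  by apply/seteqP; split; [exact: recurrent_nonwandering|exact: nonwandering_recurrent].
- exact: nonwandering_interior0.
- by split; [exact: periodic_nonwandering|exact: periodic_dense_nonwandering].
Qed.
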